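(* Let $\mathcal M$ be a manifold of dimension $n\in\mathbb N$ and let $g(t)$, $t\in[0,T]$, be a Ricci flow on $\mathcal M$, i.e. a solution of $\frac{\partial g}{\partial t}=-2\,\mathrm{Ric}(g(t))$, with uniformly bounded curvature. Suppose $N\in\mathbb N$ is sufficiently large that the tensor $\check g=\check g_N$ on $\check{\mathcal M}:=\mathcal M\times(0,T]$ defined by $$\check g_{ij}=\frac{g_{ij}}{t},\qquad \check g_{00}=\frac{N}{2t^3}+\frac{R}{t}+\frac{n}{2t^2},\qquad \check g_{0i}=0$$ is a positive definite metric. Then, up to errors of order $\frac1N$, $\check g$ is a gradient expanding Ricci soliton on $\check{\mathcal M}$, in the following sense: setting $$E_N:=\mathrm{Ric}(\check g)+\mathrm{Hess}_{\check g}\left(-\frac{N}{2t}\right)+\frac12\check g,$$ for each $k\in\{0,1,2,\dots\}$ the quantity $N\,\check\nabla^k E_N$ is bounded uniformly locally on $\check{\mathcal M}$, independently of $N$, where $\check\nabla$ is the Levi-Civita connection of $\check g$.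
   Context: The indices $i,j$ are coordinate indices on the $\mathcal M$ factor, and $0$ is the index of the coordinate $t\in(0,T]$. $R$ is the scalar curvature of $g(t)$. $\mathrm{Hess}_{\check g}(f)=\check\nabla^2 f$. ''Bounded uniformly locally, independently of $N$'' means: on each compact subset of $\check{\mathcal M}$, the covariant tensor in question is bounded (with respect to a fixed, $N$-independent background metric, equivalently in its components in fixed local coordinates) by a constant that does not depend on $N$ (for $N$ large). *)

(* Defs.v *)
From HB Require Import structures.
From mathcomp Require Import all_boot all_order all_algebra.
From mathcomp Require Import all_classical all_reals all_analysis.

Set Implicit Arguments.
Unset Strict Implicit.
Unset Printing Implicit Defensive.

Import Order.TTheory GRing.Theory Num.Theory.
Import numFieldNormedType.Exports.

Local Open Scope classical_set_scope.
Local Open Scope ring_scope.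

(** The difference quotient only uses points of D.  At an interior point of D
    this is the ordinary partial derivative; on D = [a, b] x U it is one-sided
    in the first coordinate over a and b, which is how smoothness up to the
    boundary (t = 0 for g, t = T for g and for the metric on M x (0, T]) and
    derivatives there are understood. *)

Definition diffquot (R : realType) (m : nat) (D : set 'rV[R]_m) (i : 'I_m)
    (f : 'rV[R]_m -> R) (x : 'rV[R]_m) : set_system R :=
  (fun h : R => h^-1 * (f (x + h *: delta_mx 0 i) - f x))
    @ within [set h : R | D (x + h *: delta_mx 0 i)] (0 : R)^'.

Definition pderiv (R : realType) (m : nat) (D : set 'rV[R]_m) (i : 'I_m)
    (f : 'rV[R]_m -> R) (x : 'rV[R]_m) : R :=
  lim (diffquot D i f x).

Fixpoint Ck (R : realType) (m : nat) (D : set 'rV[R]_m) (k : nat)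
    (f : 'rV[R]_m -> R) : Prop :=
  {within D, continuous f} /\
  if k is k'.+1 then
    forall i : 'I_m,
      (forall x, D x -> cvg (diffquot D i f x)) /\ Ck D k' (pderiv D i f)
  else True.

Definition smooth_on (R : realType) (m : nat) (D : set 'rV[R]_m)
    (f : 'rV[R]_m -> R) : Prop :=
  forall k : nat, Ck D k f.

(** From here to [hessian], D is the coordinate domain and G : 'rV_m -> 'M_m the matrix of components
    of the metric. *)

Definition posdef (R : realType) (m : nat) (A : 'M[R]_m) : Prop :=
  A^T = A /\ forall v : 'rV[R]_m, v != 0 -> 0 < (v *m A *m v^T) 0 0.

(** Gamma^l_{ij} *)
Definition christoffel (R : realType) (m : nat) (D : set 'rV[R]_m)
    (G : 'rV[R]_m -> 'M[R]_m) (l i j : 'I_m) (x : 'rV[R]_m) : R :=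
  2^-1 * \sum_(p < m) invmx (G x) l p *
    (pderiv D i (fun y => G y j p) x + pderiv D j (fun y => G y i p) x
     - pderiv D p (fun y => G y i j) x).

(** R_{ijk}^l, where R(d_i, d_j) d_k = R_{ijk}^l d_l and
    R(X, Y) = [nabla_X, nabla_Y] - nabla_[X, Y]. *)
Definition riemann (R : realType) (m : nat) (D : set 'rV[R]_m)
    (G : 'rV[R]_m -> 'M[R]_m) (i j k l : 'I_m) (x : 'rV[R]_m) : R :=
  pderiv D i (christoffel D G l j k) x - pderiv D j (christoffel D G l i k) x
  + \sum_(p < m) (christoffel D G p j k x * christoffel D G l i p x
                  - christoffel D G p i k x * christoffel D G l j p x).

(** Ric(Y, Z) = tr (X |-> R(X, Y) Z), positive on round spheres. *)
Definition ricci (R : realType) (m : nat) (D : set 'rV[R]_m)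
    (G : 'rV[R]_m -> 'M[R]_m) (x : 'rV[R]_m) : 'M[R]_m :=
  \matrix_(j, k) \sum_(i < m) riemann D G i j k i x.

Definition scalar_curvature (R : realType) (m : nat) (D : set 'rV[R]_m)
    (G : 'rV[R]_m -> 'M[R]_m) (x : 'rV[R]_m) : R :=
  \sum_(i < m) \sum_(j < m) invmx (G x) i j * ricci D G x i j.

(** |Rm|^2 = g^{ia} g^{jb} g^{kc} g_{ld} R_{ijk}^l R_{abc}^d *)
Definition riemann_sqnorm (R : realType) (m : nat) (D : set 'rV[R]_m)
    (G : 'rV[R]_m -> 'M[R]_m) (x : 'rV[R]_m) : R :=
  \sum_(i < m) \sum_(j < m) \sum_(k < m) \sum_(l < m)
  \sum_(a < m) \sum_(b < m) \sum_(c < m) \sum_(d < m)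
    invmx (G x) i a * invmx (G x) j b * invmx (G x) k c * G x l d
    * riemann D G i j k l x * riemann D G a b c d x.

(** Covariant tensor fields of rank k, by components. *)
Definition ctensor (R : realType) (m k : nat) : Type :=
  'rV[R]_m -> {ffun 'I_k -> 'I_m} -> R.

Definition ctensor_of_fun (R : realType) (m : nat) (f : 'rV[R]_m -> R) :
  ctensor R m 0 := fun x _ => f x.

Definition ctensor_of_mx (R : realType) (m : nat) (A : 'rV[R]_m -> 'M[R]_m) :
  ctensor R m 2 := fun x I => A x (I ord0) (I ord_max).

(** (nabla A)_{i j_1 .. j_k} = d_i A_{j_1 .. j_k}
      - sum_s sum_l Gamma^l_{i j_s} A_{j_1 .. l .. j_k}  (l in position s);
    the differentiation index comes first. *)
Definition covd (R : realType) (m : nat) (D : set 'rV[R]_m)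
    (G : 'rV[R]_m -> 'M[R]_m) (k : nat) (A : ctensor R m k) :
    ctensor R m k.+1 :=
  fun x I =>
    let i := I ord0 in
    let J : {ffun 'I_k -> 'I_m} := [ffun s => I (lift ord0 s)] in
    pderiv D i (fun y => A y J) x
    - \sum_(s < k) \sum_(l < m)
        christoffel D G l i (J s) x * A x [ffun r => if r == s then l else J r].

Fixpoint covd_iter (R : realType) (m : nat) (D : set 'rV[R]_m)
    (G : 'rV[R]_m -> 'M[R]_m) (k : nat) (A : ctensor R m k) (j : nat) :
    ctensor R m (j + k)%N :=
  match j return ctensor R m (j + k)%N with
  | 0 => A
  | j'.+1 => covd D G (@covd_iter R m D G k A j')
  end.

Arguments covd_iter {R m} D G {k} A j _ _.

Definition hessian (R : realType) (m : nat) (D : set 'rV[R]_m)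
    (G : 'rV[R]_m -> 'M[R]_m) (f : 'rV[R]_m -> R) : ctensor R m 2 :=
  covd_iter D G (ctensor_of_fun f) 2.

Record chart (R : realType) (n : nat) (M : topologicalType) := Chart {
  cdom : set M ;
  cmap : M -> 'rV[R]_n ;
  cinv : 'rV[R]_n -> M ;
  cdom_open : open cdom ;
  cimg_open : open (cmap @` cdom) ;
  cmapK : forall p, cdom p -> cinv (cmap p) = p ;
  cmap_cont : {within cdom, continuous cmap} ;
  cinv_cont : {within cmap @` cdom, continuous cinv} }.

Definition cimg (R : realType) (n : nat) (M : topologicalType)
  (c : chart R n M) : set 'rV[R]_n := cmap c @` cdom c.

Definition overlap (R : realType) (n : nat) (M : topologicalType)
  (c c' : chart R n M) : set 'rV[R]_n := cmap c @` (cdom c `&` cdom c').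

Definition transition (R : realType) (n : nat) (M : topologicalType)
  (c c' : chart R n M) (x : 'rV[R]_n) : 'rV[R]_n := cmap c' (cinv c x).

Record manifold (R : realType) (n : nat) := Manifold {
  carrier :> topologicalType ;
  manifold_hausdorff : hausdorff_space carrier ;
  manifold_second_countable : @second_countable carrier ;
  atlas : Type ;
  chart_at : atlas -> chart R n carrier ;
  atlas_cover : forall p : carrier, exists c, cdom (chart_at c) p ;
  atlas_smooth : forall (c c' : atlas) (a : 'I_n),
    smooth_on (overlap (chart_at c) (chart_at c'))
      (fun x => transition (chart_at c) (chart_at c') x 0 a) }.

(** Points of R x R^n are row vectors whose coordinate 0 is t. *)

Definition tcoord (R : realType) (n : nat) (z : 'rV[R]_n.+1) : R := z 0 ord0.

Definition xcoord (R : realType) (n : nat) (z : 'rV[R]_n.+1) : 'rV[R]_n :=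
  \row_i z 0 (lift ord0 i).

Definition txpoint (R : realType) (n : nat) (t : R) (x : 'rV[R]_n) :
    'rV[R]_n.+1 :=
  \row_i (if unlift ord0 i is Some j then x 0 j else t).

Definition flow_dom (R : realType) (n : nat) (M : manifold R n) (T : R)
    (c : atlas M) : set 'rV[R]_n.+1 :=
  [set z | cimg (chart_at c) (xcoord z) /\ 0 <= tcoord z <= T].

(** mcomp c t x is the matrix of components of g(t) in the chart c at the
    point with coordinates x. *)
Record metric_family (R : realType) (n : nat) (M : manifold R n) (T : R) :=
  MetricFamily {
  mcomp :> atlas M -> R -> 'rV[R]_n -> 'M[R]_n ;
  mcomp_smooth : forall (c : atlas M) (i j : 'I_n),
    smooth_on (flow_dom T c) (fun z => mcomp c (tcoord z) (xcoord z) i j) ;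
  mcomp_posdef : forall (c : atlas M) (t : R) (x : 'rV[R]_n),
    0 <= t <= T -> cimg (chart_at c) x -> posdef (mcomp c t x) ;
  mcomp_tensor : forall (c c' : atlas M) (t : R) (x : 'rV[R]_n) (i j : 'I_n),
    0 <= t <= T -> overlap (chart_at c) (chart_at c') x ->
    let tau := transition (chart_at c) (chart_at c') in
    let D := overlap (chart_at c) (chart_at c') in
    mcomp c t x i j =
      \sum_(a < n) \sum_(b < n)
        pderiv D i (fun y => tau y 0 a) x * pderiv D j (fun y => tau y 0 b) x
        * mcomp c' t (tau x) a b }.

Definition ricci_flow (R : realType) (n : nat) (M : manifold R n) (T : R)
    (g : metric_family M T) : Prop :=
  forall (c : atlas M) (t : R) (x : 'rV[R]_n) (i j : 'I_n),
    0 <= t <= T -> cimg (chart_at c) x ->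
    pderiv (flow_dom T c) ord0 (fun z => g c (tcoord z) (xcoord z) i j)
      (txpoint t x)
    = - 2 * ricci (cimg (chart_at c)) (g c t) x i j.

Definition bounded_curvature (R : realType) (n : nat) (M : manifold R n) (T : R)
    (g : metric_family M T) : Prop :=
  exists C : R, forall (c : atlas M) (t : R) (x : 'rV[R]_n),
    0 <= t <= T -> cimg (chart_at c) x ->
    riemann_sqnorm (cimg (chart_at c)) (g c t) x <= C.

Definition check_dom (R : realType) (n : nat) (M : manifold R n) (T : R)
    (c : atlas M) : set 'rV[R]_n.+1 :=
  [set z | cimg (chart_at c) (xcoord z) /\ 0 < tcoord z <= T].

Definition check_metric (R : realType) (n : nat) (M : manifold R n) (T : R)
    (g : metric_family M T) (N : nat) (c : atlas M) (z : 'rV[R]_n.+1) :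
    'M[R]_n.+1 :=
  let t := tcoord z in
  let x := xcoord z in
  \matrix_(i, j)
    match unlift ord0 i, unlift ord0 j with
    | Some a, Some b => g c t x a b / t
    | None, None =>
        N%:R / (2 * t ^+ 3)
        + scalar_curvature (cimg (chart_at c)) (g c t) x / t
        + n%:R / (2 * t ^+ 2)
    | _, _ => 0
    end.

Definition check_is_metric (R : realType) (n : nat) (M : manifold R n) (T : R)
    (g : metric_family M T) (N : nat) : Prop :=
  forall (c : atlas M) (z : 'rV[R]_n.+1),
    check_dom T c z -> posdef (check_metric g N c z).

Definition soliton_error (R : realType) (n : nat) (M : manifold R n) (T : R)
    (g : metric_family M T) (N : nat) (c : atlas M) : ctensor R n.+1 2 :=
  let D := check_dom T c in
  let G := check_metric g N c in
  fun z I =>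
    ctensor_of_mx (ricci D G) z I
    + hessian D G (fun w => - (N%:R / (2 * tcoord w))) z I
    + 2^-1 * ctensor_of_mx G z I.

(** Let A N be covariant tensors of rank k on M x (0, T], given by components in
    each chart of the product, for those N satisfying P.  Every compact subset
    of M x (0, T] is a finite union of compact subsets lying over chart domains,
    so it is enough to bound the components on the latter. *)
Definition bounded_unif_loc (R : realType) (n : nat) (M : manifold R n) (T : R)
    (P : nat -> Prop) (k : nat) (A : nat -> atlas M -> ctensor R n.+1 k) :
    Prop :=
  forall (c : atlas M) (K : set (M * R)),
    compact K ->
    (forall q, K q -> cdom (chart_at c) q.1 /\ 0 < q.2 <= T) ->
    exists C : R, forall N : nat, P N ->
      forall q, K q -> forall I : {ffun 'I_k -> 'I_n.+1},
        `|A N c (txpoint q.2 (cmap (chart_at c) q.1)) I| <= C.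

(* Main.v *)
(** With u = 1/N, the lapse of the metric on M x (0, T] is
    N/(2t^3) (1 + u a), a = 2 t^2 R + n t, so its inverse is O(u) and, modulo u,
    the Christoffel symbols do not depend on N.  The Ricci tensor of the limit
    connection is computed exactly: its (0i) components reduce to the
    contracted Bianchi identity and its (00) component to the evolution
    equation dR/dt = Delta R + 2 |Ric|^2, and it cancels the Hessian and metric
    terms modulo u.

    These identities hold in any commutative ring with commuting derivations.
    The ring used is that of families, indexed by N, of smooth functions on a
    chart domain; "modulo u" means up to u times a family whose derivatives of
    every order are bounded on compact sets uniformly in N.  Such families are
    stable under the covariant derivative, because they contain the Christoffel
    symbols, and u is a constant; hence N nabla^k E_N stays bounded. *)

From HB Require Import structures.
Require Import Defs.
From mathcomp Require Import all_boot all_order all_algebra.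
From mathcomp Require Import all_classical all_reals all_analysis.
From mathcomp Require Import ring lra.

Set Implicit Arguments.
Unset Strict Implicit.
Unset Printing Implicit Defensive.

Import Order.TTheory GRing.Theory Num.Theory.
Import numFieldNormedType.Exports.

Local Open Scope classical_set_scope.
Local Open Scope ring_scope.

(** * Differential rings and Levi-Civita connections *)

(** Congruence modulo u is too coarse for the Hessian: the potential -N/(2t) has a derivative of
    order N, so Gamma^0_{ij} is needed modulo u^2. It is therefore kept as an exact formula, in
    which N times the inverse lapse is 2 t^3 w with w = 1/(1 + u a), and only afterwards is w
    replaced by 1. In the (00) component terms of order N remain and have to cancel exactly. N
    itself lies in the ring without being bounded, so congruences relate arbitrary elements, and
    boundedness is asked only of limits and errors. The ring must also contain w, that is, 1 + u a
    may vanish nowhere over the chart, not merely where u a is small. Positivity of the metric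
    ensures this, which is why the families are indexed by those N for which the tensor is a metric.
    Derivatives at t = T are one-sided, so the coordinate domains are not open. Uniqueness of
    derivatives and symmetry of mixed ones rest instead on small boxes extending from each point in
    the negative coordinate directions. *)

Definition derivation (A : comPzRingType) (d : A -> A) : Prop :=
  (forall a b, d (a + b) = d a + d b) /\
  (forall a b, d (a * b) = d a * b + a * d b).

Section Derivation.
Variables (A : comPzRingType) (d : A -> A).
Hypothesis hd : derivation d.

Lemma derD a b : d (a + b) = d a + d b. Proof. exact: hd.1. Qed.
Lemma derM a b : d (a * b) = d a * b + a * d b. Proof. exact: hd.2. Qed.
Lemma der0 : d 0 = 0.
Proof. by apply: (addrI (d 0)); rewrite -derD !addr0. Qed.
Lemma derN a : d (- a) = - d a.
Proof. by apply: (addrI (d a)); rewrite -derD !subrr der0. Qed.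
Lemma derB a b : d (a - b) = d a - d b.
Proof. by rewrite derD derN. Qed.
Lemma der1 : d 1 = 0.
Proof. by apply: (addrI (d 1)); rewrite addr0 -{3}[1]mulr1 derM mulr1 mul1r. Qed.
Lemma der_nat n : d n%:R = 0.
Proof. by elim: n => [|n IH]; rewrite ?der0 // -natr1 derD der1 IH addr0. Qed.
Lemma der_sum (I : Type) (r : seq I) (P : pred I) (F : I -> A) :
  d (\sum_(i <- r | P i) F i) = \sum_(i <- r | P i) d (F i).
Proof. exact: (big_morph d derD der0). Qed.
Lemma der_sumM (I : finType) (F F' : I -> A) :
  d (\sum_i F i * F' i) = \sum_i d (F i) * F' i + \sum_i F i * d (F' i).
Proof. by rewrite der_sum -big_split; apply: eq_bigr => i _; rewrite derM. Qed.
Lemma der_mulmx m n p (X : 'M[A]_(m, n)) (Y : 'M[A]_(n, p)) :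
  map_mx d (X *m Y) = map_mx d X *m Y + X *m map_mx d Y.
Proof.
apply/matrixP => i j; rewrite !mxE der_sum -big_split; apply: eq_bigr => k _.
by rewrite derM !mxE.
Qed.
Lemma derV a b : a * b = 1 -> d b = - (b * b * d a).
Proof.
move=> ab; have: d (a * b) = 0 by rewrite ab der1.
rewrite derM => /eqP; rewrite addrC addr_eq0 => /eqP e.
by rewrite -[d b]mul1r -ab -mulrA [b * d b]mulrC mulrA e; ring.
Qed.
End Derivation.

(* Indices run over 'I_m, H is the inverse matrix of G, and C l i j stands for
   Gamma^l_{ij}.  The ring need not contain rational scalars: [half] is any
   element with half + half = 1. *)
Section Connection.
Variables (A : comPzRingType) (m : nat) (d : 'I_m -> A -> A).

Definition chr (half : A) (G H : 'I_m -> 'I_m -> A) (l i j : 'I_m) : A :=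
  half * \sum_p H l p * (d i (G j p) + d j (G i p) - d p (G i j)).

Definition curv (C : 'I_m -> 'I_m -> 'I_m -> A) (i j k l : 'I_m) : A :=
  d i (C l j k) - d j (C l i k)
  + \sum_p (C p j k * C l i p - C p i k * C l j p).

Definition ric (C : 'I_m -> 'I_m -> 'I_m -> A) (j k : 'I_m) : A :=
  \sum_i curv C i j k i.
End Connection.

(** Exchanging the indices shows that the sum is its own negative, and [half] makes 2 invertible. *)
Lemma sum_sym_antisym (A : comPzRingType) (half : A) (I : finType)
    (X Y : I -> I -> A) :
  half + half = 1 -> (forall i j, X i j = X j i) ->
  (forall i j, Y i j = - Y j i) -> \sum_i \sum_j X i j * Y i j = 0.
Proof.
move=> hh Xs Ya; set s := \sum_i _.
have e : s = - s.
  rewrite {1}/s exchange_big /= /s -sumrN; apply: eq_bigr => i _.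
  by rewrite -sumrN; apply: eq_bigr => j _; rewrite Xs Ya mulrN.
by rewrite -[s]mul1r -hh mulrDl {2}e mulrN subrr.
Qed.

(** * Curvature of a matrix-valued connection and the Bianchi identities *)

Section MatrixBianchi.
Variables (A : comPzRingType) (m : nat) (d : 'I_m -> A -> A).
Hypothesis dd : forall i, derivation (d i).
Hypothesis dC : forall i j a, d i (d j a) = d j (d i a).
Variables (C : 'I_m -> 'M[A]_m) (H : 'M[A]_m).
Hypothesis HT : H^T = H.
Hypothesis dH : forall a, map_mx (d a) H = - (C a *m H + H *m (C a)^T).

(** The curvature d omega + omega wedge omega of the connection form whose matrices are Gamma^l_{ik}
    with row l and column k. After multiplication by [H] both matrix indices are upper, so that
    antisymmetry in them is a statement about the transpose. *)
Definition curvmx (i j : 'I_m) : 'M[A]_m :=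
  map_mx (d i) (C j) - map_mx (d j) (C i) + C i *m C j - C j *m C i.

Let mxder a p q r (X : 'M[A]_(p, q)) (Y : 'M[A]_(q, r)) :
  map_mx (d a) (X *m Y) = map_mx (d a) X *m Y + X *m map_mx (d a) Y.
Proof. exact: der_mulmx. Qed.
Let mxderD a p q (X Y : 'M[A]_(p, q)) :
  map_mx (d a) (X + Y) = map_mx (d a) X + map_mx (d a) Y.
Proof. by apply/matrixP => i j; rewrite !mxE derD. Qed.
Let mxderN a p q (X : 'M[A]_(p, q)) :
  map_mx (d a) (- X) = - map_mx (d a) X.
Proof. by apply/matrixP => i j; rewrite !mxE derN. Qed.
Let mxderC a b p q (X : 'M[A]_(p, q)) :
  map_mx (d a) (map_mx (d b) X) = map_mx (d b) (map_mx (d a) X).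
Proof. by apply/matrixP => i j; rewrite !mxE dC. Qed.

(* [move:] rather than [generalize]: equal products may carry convertible but
   syntactically different ring instances. *)
Ltac mxring :=
  rewrite ?(mulmxDl, mulmxDr, mulNmx, mulmxN, mulmxA);
  repeat match goal with |- context [@mulmx ?a ?b ?c ?e ?X ?Y] =>
    move: (@mulmx a b c e X Y) => ? end;
  repeat match goal with
    |- context [@map_mx ?a ?b ?c ?e ?X ?Y] =>
    move: (@map_mx a b c e X Y) => ? end;
  apply/matrixP => ? ?; rewrite !mxE; ring.

Lemma curvmxN i j : curvmx i j *m H = - (curvmx j i *m H).
Proof. rewrite /curvmx; mxring. Qed.

(** The Ricci identity for the parallel tensor [H]: [d i] and [d j] commute on [H], and expanding
    both sides by [dH] leaves F_ij H + H F_ij^T = 0. *)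
Lemma curvmx_tr i j : (curvmx i j *m H)^T = - (curvmx i j *m H).
Proof.
have := mxderC i j H.
rewrite !dH !(mxderN, mxderD, mxder) -!map_trmx !dH => e.
rewrite trmx_mul HT /curvmx !linearB !linearD /= !linearN /= !trmx_mul.
move/eqP: e; rewrite -subr_eq0 => /eqP e.
apply/eqP; rewrite -subr_eq0; apply/eqP; rewrite -oppr0 -[in RHS]e.
mxring.
Qed.

(** Each bracket is a covariant derivative in the two matrix indices only: for a torsion-free
    connection the Christoffel terms in the form indices cancel in the cyclic sum. By [dH] the
    factor [H] is parallel, so the identity is that of F itself. *)
Lemma bianchi_mx a i j :
  (map_mx (d a) (curvmx i j *m H) + C a *m (curvmx i j *m H)
    + curvmx i j *m H *m (C a)^T)
  + (map_mx (d i) (curvmx j a *m H) + C i *m (curvmx j a *m H)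
    + curvmx j a *m H *m (C i)^T)
  + (map_mx (d j) (curvmx a i *m H) + C j *m (curvmx a i *m H)
    + curvmx a i *m H *m (C j)^T) = 0.
Proof.
rewrite /curvmx !(mxderN, mxderD, mxder) !dH.
rewrite (mxderC i a) (mxderC j a) (mxderC j i).
mxring.
Qed.
End MatrixBianchi.

Section Bianchi.
Variables (A : comPzRingType) (half : A) (m : nat) (d : 'I_m -> A -> A).
Hypothesis half2 : half + half = 1.
Hypothesis dd : forall i, derivation (d i).
Hypothesis dC : forall i j a, d i (d j a) = d j (d i a).
Variables (C : 'I_m -> 'I_m -> 'I_m -> A) (H : 'I_m -> 'I_m -> A).
Hypothesis Csym : forall l i j, C l i j = C l j i.
Hypothesis Hsym : forall i j, H i j = H j i.
Hypothesis dH : forall a i j,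
  d a (H i j) = - \sum_p (C i a p * H p j + C j a p * H i p).

Definition ricci_endo (l a : 'I_m) : A := \sum_p H l p * ric d C a p.
Definition scal : A := \sum_i ricci_endo i i.
Definition chr_tr (k : 'I_m) : A := \sum_i C i i k.

(* The curvature with its last index raised, F_ij H, is antisymmetric in both
   pairs of indices; the identity is the double trace of the second Bianchi
   identity for F_ij H. *)
Lemma contracted_bianchi a :
  \sum_i d i (ricci_endo i a) + \sum_p chr_tr p * ricci_endo p a
  - \sum_i \sum_p C i a p * ricci_endo p i = half * d a scal.
Proof.
pose Cm i : 'M[A]_m := \matrix_(l, k) C l i k.
pose Hm : 'M[A]_m := \matrix_(l, k) H l k.
pose Mm i j := curvmx d Cm i j *m Hm.
have curvE i j k l : curv d C i j k l = curvmx d Cm i j l k.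
  rewrite /curv /curvmx !mxE sumrB addrA.
  congr (_ - _ + _ - _);
    by apply: eq_bigr => p _; rewrite !mxE mulrC.
have dHm b : map_mx (d b) Hm = - (Cm b *m Hm + Hm *m (Cm b)^T).
  apply/matrixP => i j; rewrite !mxE dH -big_split /=; congr (- _).
  by apply: eq_bigr => p _; rewrite !mxE; ring.
have HmE i j : Hm i j = H i j by rewrite mxE.
have HmT : Hm^T = Hm by apply/matrixP => i j; rewrite !mxE.
have ricci_endoE l b : ricci_endo l b = \sum_i Mm i b i l.
  rewrite /ricci_endo /ric /Mm.
  under eq_bigr do rewrite mulr_sumr.
  rewrite exchange_big; apply: eq_bigr => i _; rewrite [RHS]mxE.
  by apply: eq_bigr => p _; rewrite curvE HmE [H l p]Hsym mulrC.
have BM b i j := bianchi_mx dd dC dHm b i j.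
rewrite -!/(Mm _ _) in BM.
have Mt i j l k : Mm i j l k = - Mm i j k l.
  by rewrite -[in LHS](opprK (Mm i j)) -(curvmx_tr dd dC HmT dHm) !mxE.
have Ms i j l k : Mm i j l k = - Mm j i l k by rewrite /Mm curvmxN mxE.
(* By the two antisymmetries every mixed trace of F H is plus or minus the Ricci endomorphism. *)
have tr1 i p : \sum_j Mm i j p j = ricci_endo p i.
  by rewrite ricci_endoE; apply: eq_bigr => j _; rewrite Ms Mt opprK.
have tr2 a' p : \sum_j Mm j a' p j = - ricci_endo p a'.
  by rewrite -tr1 -sumrN; apply: eq_bigr => j _; rewrite Ms.
have tr3 a' p : \sum_i Mm a' i i p = - ricci_endo p a'.
  by rewrite ricci_endoE -sumrN; apply: eq_bigr => j _; rewrite Ms.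


have entry c X l k : (map_mx (d c) X + Cm c *m X + X *m (Cm c)^T) l k =
    d c (X l k) + \sum_p C l c p * X p k + \sum_p C k c p * X l p.
  rewrite !mxE; congr (_ + _ + _); apply: eq_bigr => p _; rewrite !mxE //.
  exact: mulrC.
have sum3 (F1 F2 F3 : 'I_m -> 'I_m -> A) : \sum_i \sum_j (F1 i j + F2 i j + F3 i j)
    = \sum_i \sum_j F1 i j + \sum_i \sum_j F2 i j + \sum_i \sum_j F3 i j.
  by rewrite -!big_split; apply: eq_bigr => i _; rewrite -!big_split.
(* Under the double trace the term differentiated in direction a gives the derivative of the scalar
   curvature, and each of the other two gives minus the divergence of Ricci; hence the factor
   [half]. *)
have P1 : \sum_i \sum_j (map_mx (d a) (Mm i j) + Cm a *m Mm i j
      + Mm i j *m (Cm a)^T) i j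
    = d a scal + \sum_i \sum_p C i a p * ricci_endo p i
      + \sum_i \sum_p C i a p * ricci_endo p i.
  under eq_bigr do under eq_bigr do rewrite entry.
  rewrite sum3; congr (_ + _ + _).
  - rewrite /scal der_sum //; apply: eq_bigr => i _.
    by rewrite -tr1 der_sum.
  - apply: eq_bigr => i _; rewrite exchange_big; apply: eq_bigr => p _.
    by rewrite -tr1 mulr_sumr.
  - rewrite exchange_big; apply: eq_bigr => j _.
    rewrite exchange_big; apply: eq_bigr => p _.
    by rewrite ricci_endoE mulr_sumr.
have P2 : \sum_i \sum_j (map_mx (d i) (Mm j a) + Cm i *m Mm j a
      + Mm j a *m (Cm i)^T) i j
    = - \sum_i d i (ricci_endo i a) - \sum_p chr_tr p * ricci_endo p a.
  under eq_bigr do under eq_bigr do rewrite entry.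
  (* The third sum pairs the symmetric lower indices of [C] with an antisymmetric pair of F H. *)
  rewrite sum3 [X in _ + _ + X]exchange_big [X in _ + _ + X]big1 ?addr0; last first.
    by move=> j _; apply: (sum_sym_antisym half2) => // i k; exact: Mt.
  congr (_ + _).
  - rewrite -sumrN; apply: eq_bigr => i _.
    by rewrite -der_sum // tr2 derN.
  - rewrite -sumrN exchange_big /=.
    under eq_bigr do rewrite exchange_big.
    rewrite exchange_big; apply: eq_bigr => p _ /=.
    under eq_bigr do rewrite -mulr_suml.
    by rewrite -mulr_sumr tr2 mulrN.
have P3 : \sum_i \sum_j (map_mx (d j) (Mm a i) + Cm j *m Mm a i
      + Mm a i *m (Cm j)^T) i j
    = - \sum_i d i (ricci_endo i a) - \sum_p chr_tr p * ricci_endo p a.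
  rewrite -P2 exchange_big; apply: eq_bigr => i _; apply: eq_bigr => j _.
  rewrite !entry addrAC; congr (_ + _ + _).
  - by rewrite Ms Mt opprK.
  - by apply: eq_bigr => p _; rewrite Ms Mt opprK.
  - by apply: eq_bigr => p _; rewrite Ms Mt opprK.
have P0 : \sum_i \sum_j ((map_mx (d a) (Mm i j) + Cm a *m Mm i j + Mm i j *m (Cm a)^T)
  + (map_mx (d i) (Mm j a) + Cm i *m Mm j a + Mm j a *m (Cm i)^T)
  + (map_mx (d j) (Mm a i) + Cm j *m Mm a i + Mm a i *m (Cm j)^T)) i j = 0.
  by rewrite big1 // => i _; rewrite big1 // => j _; rewrite BM mxE.
have addE (X Y Z : 'M[A]_m) i j : (X + Y + Z) i j = X i j + Y i j + Z i j.
  by rewrite !mxE.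
move: P0; under eq_bigr do under eq_bigr do rewrite addE.
rewrite sum3 P1 P2 P3.
set dv := \sum_i d i _; set cs := \sum_i \sum_p _; set gs := \sum_p _.
move=> P0; rewrite -[LHS]mul1r -half2.
have : half * (d a scal + cs + cs + (- dv - gs) + (- dv - gs)) = 0.
  by rewrite P0 mulr0.
move/eqP; rewrite -subr_eq0 => /eqP e; apply/eqP; rewrite -subr_eq0.
by apply/eqP; rewrite -oppr0 -e; ring.
Qed.
End Bianchi.

Lemma sum_delta (A : comPzRingType) (I : finType) (q : I) (X : I -> A) :
  \sum_p (q == p)%:R * X p = X q.
Proof.
rewrite (bigD1 q) //= eqxx mul1r big1 ?addr0 // => p pq.
by rewrite eq_sym (negPf pq) mul0r.
Qed.

Lemma sum_inv (A : comPzRingType) (I : finType) (X Y : I -> I -> A)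
    (Z : I -> A) (q : I) :
  (forall i j, \sum_p X i p * Y p j = (i == j)%:R) ->
  \sum_l X q l * (\sum_p Y l p * Z p) = Z q.
Proof.
move=> XY; under eq_bigr do rewrite mulr_sumr.
rewrite exchange_big /= -[RHS]sum_delta; apply: eq_bigr => p _.
by under eq_bigr do rewrite mulrA; rewrite -mulr_suml XY.
Qed.

(** * The Levi-Civita connection of a symmetric invertible matrix *)

Section LeviCivita.
Variables (A : comPzRingType) (half : A) (m : nat) (d : 'I_m -> A -> A).
Hypothesis half2 : half + half = 1.
Hypothesis dd : forall i, derivation (d i).
Hypothesis dC : forall i j a, d i (d j a) = d j (d i a).
Variables (G H : 'I_m -> 'I_m -> A).
Hypothesis Gsym : forall i j, G i j = G j i.
Hypothesis HG : forall i j, \sum_p H i p * G p j = (i == j)%:R.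

Let Gm : 'M[A]_m := \matrix_(i, j) G i j.
Let Hm : 'M[A]_m := \matrix_(i, j) H i j.
Let HGm : Hm *m Gm = 1%:M.
Proof.
apply/matrixP => i j; rewrite !mxE -HG.
by apply: eq_bigr => p _; rewrite !mxE.
Qed.
Let GHm : Gm *m Hm = 1%:M. Proof. exact: mulmx1C HGm. Qed.
Let GmT : Gm^T = Gm. Proof. by apply/matrixP => i j; rewrite !mxE. Qed.

Lemma inv_mxK i j : \sum_p G i p * H p j = (i == j)%:R.
Proof.
have /matrixP/(_ i j) := GHm; rewrite !mxE => <-.
by apply: eq_bigr => p _; rewrite !mxE.
Qed.

Lemma inv_sym i j : H i j = H j i.
Proof.
suff /matrixP/(_ i j) : Hm = Hm^T by rewrite !mxE.
by rewrite -[RHS]mulmx1 -GHm -{1}GmT mulmxA -trmx_mul GHm trmx1 mul1mx.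
Qed.

Local Notation C := (chr d half G H).

Lemma chr_sym l i j : C l i j = C l j i.
Proof.
by congr (_ * _); apply: eq_bigr => p _; rewrite (Gsym i j); congr (_ * _); ring.
Qed.

Let lower q i j :
  \sum_l G q l * C l i j = half * (d i (G j q) + d j (G i q) - d q (G i j)).
Proof.
under eq_bigr do rewrite mulrCA.
by rewrite -mulr_sumr sum_inv //; exact: inv_mxK.
Qed.

Lemma chr_compat a i j :
  d a (G i j) = \sum_p (C p a i * G p j + C p a j * G p i).
Proof.
rewrite big_split /=.
under eq_bigr do rewrite mulrC Gsym.
under [X in _ + X]eq_bigr do rewrite mulrC Gsym.
by rewrite !lower -[LHS]mul1r -half2 (Gsym j i); ring.
Qed.

Let dinv a : map_mx (d a) Hm = - (Hm *m map_mx (d a) Gm *m Hm).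
Proof.
have: map_mx (d a) (Hm *m Gm) = 0.
  by rewrite HGm; apply/matrixP => i j; rewrite !mxE der_nat.
rewrite der_mulmx // => /eqP; rewrite addr_eq0 => /eqP e.
by rewrite -[LHS]mulmx1 -GHm mulmxA e mulNmx.
Qed.

Lemma chr_compat_inv a i j :
  d a (H i j) = - \sum_p (C i a p * H p j + C j a p * H i p).
Proof.
pose Cm : 'M[A]_m := \matrix_(l, k) C l a k.
have dGm : map_mx (d a) Gm = Gm *m Cm + Cm^T *m Gm.
  apply/matrixP => r s; rewrite !mxE chr_compat -big_split /=.
  apply: eq_bigr => p _; rewrite !mxE (Gsym p r); ring.
have /matrixP/(_ i j) := dinv a.
rewrite dGm mulmxDr mulmxDl mulmxA HGm mul1mx -!mulmxA GHm mulmx1 !mxE => ->.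
rewrite -big_split /=; congr (- _); apply: eq_bigr => p _.
by rewrite !mxE; ring.
Qed.

(** This is the derivative of log sqrt(det G), written without a logarithm. The other two
    derivatives in the Christoffel symbol are antisymmetric in the indices contracted with the
    symmetric [H]. *)
Lemma chr_trE k : chr_tr C k = half * \sum_i \sum_p H i p * d k (G i p).
Proof.
rewrite /chr_tr /chr -mulr_sumr; congr (_ * _).
apply/eqP; rewrite -subr_eq0 -sumrB; apply/eqP.
under eq_bigr do rewrite -sumrB.
under eq_bigr => i _ do under eq_bigr => p _ do
  rewrite -mulrBr (Gsym k p).
apply: (sum_sym_antisym half2); first exact: inv_sym.
by move=> i p; rewrite (Gsym i k) (Gsym i p); ring.
Qed.

(** The delicate term is d_j Gamma^i_{ik}, a second derivative of log sqrt(det G). As the ring has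
    no logarithm, its symmetry is derived from [chr_trE], commuting derivations and cyclicity of the
    trace. *)
Lemma ric_sym j k : ric d C j k = ric d C k j.
Proof.
have dtr a b : d a (chr_tr C b) = d b (chr_tr C a).
  pose D c : 'M[A]_m := map_mx (d c) Gm.
  have E c : \sum_i \sum_p H i p * d c (G i p) = \tr (Hm *m D c).
    apply: eq_bigr => i _; rewrite mxE; apply: eq_bigr => p _.
    by rewrite !mxE (Gsym i).
  have tr c c' : d c (\tr (Hm *m D c'))
      = \tr (Hm *m map_mx (d c) (D c')) - \tr (Hm *m D c *m Hm *m D c').
    transitivity (\tr (map_mx (d c) (Hm *m D c'))).
      by rewrite der_sum //; apply: eq_bigr => i _; rewrite [RHS]mxE.
    by rewrite der_mulmx // dinv mulNmx !linearD /= linearN /= addrC.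
  have dh c : d c half = 0.
    have := der1 (dd c); rewrite -half2 derD // => e.
    by rewrite -[LHS]mul1r -half2 mulrDl -mulrDr e mulr0.
  rewrite !chr_trE !E !(derM (dd _)) !dh !mul0r !add0r !tr.
  congr (_ * (_ - _)).
    congr (\tr (_ *m _)); apply/matrixP => i p; rewrite !mxE; exact: dC.
  by rewrite -!mulmxA mulmxA mxtrace_mulC mulmxA.
have ricE a b : ric d C a b = \sum_i d i (C i a b) - d a (chr_tr C b)
   + \sum_i \sum_p (C p a b * C i i p - C p i b * C i a p).
  by rewrite /ric /curv big_split /= sumrB /chr_tr der_sum.
rewrite !ricE (dtr j k); congr (_ - _ + _).
  by apply: eq_bigr => i _; rewrite chr_sym.
rewrite (eq_bigr _ (fun i _ => sumrB _ _ _ _)).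
rewrite [RHS](eq_bigr _ (fun i _ => sumrB _ _ _ _)).
rewrite !sumrB; congr (_ - _).
  by apply: eq_bigr => i _; apply: eq_bigr => p _; rewrite (chr_sym p j k).
rewrite exchange_big; apply: eq_bigr => i _; apply: eq_bigr => p _.
by rewrite mulrC (chr_sym i p) (chr_sym p j).
Qed.
End LeviCivita.

Lemma der_inv_mx (A : comPzRingType) (m : nat) (d : A -> A)
    (G H : 'I_m -> 'I_m -> A) (i j : 'I_m) :
  derivation d ->
  (forall i j, \sum_p H i p * G p j = (i == j)%:R) ->
  (forall i j, \sum_p G i p * H p j = (i == j)%:R) ->
  d (H i j) = - \sum_b (\sum_a H i a * d (G a b)) * H b j.
Proof.
move=> dd HG GH.
pose Gm : 'M[A]_m := \matrix_(i, j) G i j.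
pose Hm : 'M[A]_m := \matrix_(i, j) H i j.
have HGm : Hm *m Gm = 1%:M.
  apply/matrixP => k l; rewrite !mxE -HG.
  by apply: eq_bigr => p _; rewrite !mxE.
have GHm : Gm *m Hm = 1%:M by exact: mulmx1C.
have: map_mx d (Hm *m Gm) = 0.
  by rewrite HGm; apply/matrixP => k l; rewrite !mxE der_nat.
rewrite der_mulmx // => /eqP; rewrite addr_eq0 => /eqP e.
have /matrixP/(_ i j) : map_mx d Hm = - (Hm *m map_mx d Gm *m Hm).
  by rewrite -[LHS]mulmx1 -GHm mulmxA e mulNmx.
rewrite !mxE => ->; congr (- _); apply: eq_bigr => b _.
by rewrite !mxE; congr (_ * _); apply: eq_bigr => a _; rewrite !mxE.
Qed.

Lemma sum2M (A : comPzRingType) (I J : finType) (k : A) (F : I -> J -> A) :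
  k * (\sum_i \sum_j F i j) = \sum_i \sum_j k * F i j.
Proof. by rewrite mulr_sumr; apply: eq_bigr => i _; rewrite mulr_sumr. Qed.

Lemma sum2D (A : comPzRingType) (I J : finType) (F F' : I -> J -> A) :
  \sum_i \sum_j (F i j + F' i j) = \sum_i \sum_j F i j + \sum_i \sum_j F' i j.
Proof. by rewrite -big_split; apply: eq_bigr => i _; rewrite big_split. Qed.

Lemma sum2N (A : comPzRingType) (I J : finType) (F : I -> J -> A) :
  \sum_i \sum_j - F i j = - (\sum_i \sum_j F i j).
Proof. by rewrite -sumrN; apply: eq_bigr => i _; rewrite sumrN. Qed.

Lemma eq_sum2 (A : comPzRingType) (I J : finType) (F F' : I -> J -> A) :
  (forall i j, F i j = F' i j) ->
  \sum_i \sum_j F i j = \sum_i \sum_j F' i j.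
Proof. by move=> e; apply: eq_bigr => i _; apply: eq_bigr. Qed.

Lemma sum3_rot (A : comPzRingType) (I J K : finType) (F : I -> J -> K -> A) :
  \sum_i \sum_j \sum_k F i j k = \sum_j \sum_k \sum_i F i j k.
Proof. by rewrite exchange_big; apply: eq_bigr => j _; exact: exchange_big. Qed.

Lemma sum4_swap (A : comPzRingType) (I J K L : finType)
    (F : I -> J -> K -> L -> A) :
  \sum_i \sum_j \sum_a \sum_b F i j a b = \sum_a \sum_b \sum_i \sum_j F i j a b.
Proof.
rewrite pair_big /= [RHS]pair_big /=.
under eq_bigr do rewrite pair_big.
under [RHS]eq_bigr do rewrite pair_big.
exact: exchange_big.
Qed.

Lemma der_sum2M (A : comPzRingType) (d : A -> A) (I J : finType)
    (F F' : I -> J -> A) :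
  derivation d ->
  d (\sum_i \sum_j F i j * F' i j)
  = \sum_i \sum_j d (F i j) * F' i j + \sum_i \sum_j F i j * d (F' i j).
Proof.
move=> dd; rewrite der_sum // -sum2D; apply: eq_bigr => i _.
by rewrite der_sumM // -big_split.
Qed.

(** * Ricci flow *)

Section RicciFlow.
Variables (A : comPzRingType) (half : A) (m : nat).
Variables (d : 'I_m -> A -> A) (dt : A -> A).
Hypothesis half2 : half + half = 1.
Hypothesis dd : forall i, derivation (d i).
Hypothesis ddt : derivation dt.
Hypothesis dC : forall i j a, d i (d j a) = d j (d i a).
Hypothesis dtC : forall i a, dt (d i a) = d i (dt a).
Variables (G H : 'I_m -> 'I_m -> A).
Hypothesis Gsym : forall i j, G i j = G j i.
Hypothesis HG : forall i j, \sum_p H i p * G p j = (i == j)%:R.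

Local Notation C := (chr d half G H).
Local Notation Ric := (ric d C).
Local Notation S := (ricci_endo d C H).
Local Notation Rs := (scal d C H).
Local Notation gam := (chr_tr C).

Hypothesis flow : forall i j, dt (G i j) = - (Ric i j + Ric i j).

Let GH := inv_mxK HG.
Let Hsym := inv_sym Gsym HG.
Let Csym := chr_sym half d H Gsym.
Let Rsym := ric_sym half2 dd dC Gsym HG.
Let dH := chr_compat_inv half2 dd Gsym HG.

(** Ric^{ij}, the Ricci tensor with both indices raised. *)
Let SH i j := \sum_q S i q * H q j.

Let SHE i j : SH i j = \sum_a \sum_b H i a * H j b * Ric a b.
Proof.
rewrite exchange_big; apply: eq_bigr => q _ /=; rewrite mulr_suml.
by apply: eq_bigr => p _; rewrite (Hsym q) (Rsym q); ring.
Qed.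

Let SHsym i j : SH i j = SH j i.
Proof.
rewrite !SHE exchange_big; apply: eq_sum2 => a b; rewrite (Rsym b); ring.
Qed.

Lemma flow_inv i j : dt (H i j) = SH i j + SH i j.
Proof.
rewrite (der_inv_mx _ _ ddt HG GH) SHE exchange_big -big_split -sumrN.
apply: eq_bigr => b _; rewrite mulr_suml -big_split -sumrN.
by apply: eq_bigr => a _ /=; rewrite flow (Hsym j); ring.
Qed.

Let derhalf (D : A -> A) : derivation D -> D half = 0.
Proof.
move=> dD; have := der1 dD; rewrite -half2 derD // => e.
by rewrite -[LHS]mul1r -half2 mulrDl -mulrDr e mulr0.
Qed.

Let dbl x : half * (x + x) = x.
Proof. by rewrite -[RHS]mul1r -half2; ring. Qed.

Let RsE : Rs = \sum_i \sum_j H i j * Ric i j.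
Proof. by []. Qed.

(** The volume density evolves by d/dt log sqrt(det G) = -R, and this is the gradient of that
    equation, computed from [chr_trE]. *)
Let flow_chr_tr k : dt (gam k) = - d k Rs.
Proof.
rewrite (chr_trE d half2 Gsym HG) derM // derhalf // mul0r add0r (der_sum2M _ _ ddt).
rewrite RsE (der_sum2M _ _ (dd k)) opprD mulrDr; congr (_ + _).
  transitivity (\sum_i \sum_j SH i j * d k (G i j)).
    by rewrite sum2M; apply: eq_sum2 => i j; rewrite flow_inv mulrA dbl.
  have e i j : d k (H i j) * Ric i j
      = - (\sum_b \sum_a H i a * H j b * d k (G a b) * Ric i j).
    rewrite (der_inv_mx _ _ (dd k) HG GH) mulNr mulr_suml; congr (- _).
    apply: eq_bigr => b _; rewrite -mulrA mulr_suml; apply: eq_bigr => a _.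
    by rewrite (Hsym j); ring.
  rewrite (eq_sum2 e) sum2N opprK.
  transitivity (\sum_i \sum_j \sum_a \sum_b
      H i a * H j b * Ric a b * d k (G i j)).
    apply: eq_sum2 => i j; rewrite SHE mulr_suml.
    by apply: eq_bigr => a _; rewrite mulr_suml.
  rewrite sum4_swap; apply: eq_sum2 => a b; rewrite exchange_big.
  by apply: eq_sum2 => j i; rewrite (Hsym i) (Hsym j); ring.
rewrite -sum2N sum2M; apply: eq_sum2 => i j.
by rewrite dtC flow derN // derD // -[in RHS](dbl (d k (Ric i j))); ring.
Qed.

(** Minus the Laplacian of the i-th coordinate function. *)
Let bet i := \sum_j \sum_k H j k * C i j k.

(** A trace of the compatibility of [H]. Its time derivative yields [trace_flow_chr]. *)
Lemma div_inv i : \sum_j d j (H i j) = - bet i - \sum_p H i p * gam p.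
Proof.
under eq_bigr do rewrite dH.
rewrite sumrN -opprD; congr (- _); rewrite sum2D; congr (_ + _).
  by apply: eq_sum2 => j p; rewrite (Hsym p) mulrC.
rewrite exchange_big; apply: eq_bigr => p _; rewrite mulrC mulr_suml.
exact: eq_bigr.
Qed.

(** The contracted Bianchi identity for Ric^{ij}: the derivative of the raising factor [H] is
    expanded by [dH], and part of it cancels the Christoffel term of the mixed form. *)
Let div_SH i : \sum_j d j (SH i j) = half * (\sum_q H i q * d q Rs)
  - \sum_p SH i p * gam p - \sum_j \sum_p SH j p * C i j p.
Proof.
under eq_bigr do rewrite SHsym der_sumM //.
rewrite big_split /=.
have -> : \sum_j \sum_q d j (S j q) * H q i = half * (\sum_q H i q * d q Rs)
  - \sum_p SH i p * gam p + \sum_q \sum_a \sum_b C a q b * S b a * H q i.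
  rewrite exchange_big mulr_sumr.
  have -> : \sum_p SH i p * gam p = \sum_q \sum_p gam p * S p q * H q i.
    rewrite exchange_big; apply: eq_bigr => p _; rewrite SHsym mulrC mulr_sumr.
    by apply: eq_bigr => q _; rewrite mulrA.
  rewrite -sumrB -big_split; apply: eq_bigr => q _ /=.
  rewrite -mulr_suml; under [X in _ + X]eq_bigr do rewrite -mulr_suml.
  rewrite -!mulr_suml mulrCA -(contracted_bianchi half2 dd dC Csym Hsym dH) Hsym.
  by ring.
have -> : \sum_j \sum_q S j q * d j (H q i)
  = - \sum_q \sum_a \sum_b C a q b * S b a * H q i
    - \sum_j \sum_p SH j p * C i j p.
  under eq_sum2 => j q do rewrite dH mulrN big_split mulrDr.
  rewrite sum2N sum2D opprD; congr (- _ - _).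
    under eq_sum2 => j q do rewrite mulr_sumr.
    rewrite exchange_big /=.
    under eq_bigr do rewrite exchange_big.
    rewrite exchange_big; apply: eq_sum2 => p q; apply: eq_bigr => j _.
    by rewrite (Csym q j p); ring.
  apply: eq_bigr => j _.
  under eq_bigr do rewrite mulr_sumr.
  rewrite exchange_big; apply: eq_bigr => p _; rewrite mulr_suml.
  by apply: eq_bigr => q _; ring.
by ring.
Qed.

(* H^{jk} dt(Gamma^i_{jk}) is the vector dual to -(2 div Ric - dR), which
   vanishes by the contracted Bianchi identity. *)
Let trace_flow_chr i : \sum_j \sum_k H j k * dt (C i j k) = 0.
Proof.
have e1 : \sum_j dt (d j (H i j)) = \sum_j d j (SH i j) + \sum_j d j (SH i j).
  by rewrite -big_split; apply: eq_bigr => j _; rewrite dtC flow_inv derD.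
have e2 : \sum_j \sum_k dt (H j k) * C i j k
    = \sum_j \sum_k SH j k * C i j k + \sum_j \sum_k SH j k * C i j k.
  by rewrite -sum2D; apply: eq_sum2 => j k; rewrite flow_inv mulrDl.
have e3 : \sum_p dt (H i p) * gam p
    = \sum_p SH i p * gam p + \sum_p SH i p * gam p.
  by rewrite -big_split; apply: eq_bigr => p _; rewrite flow_inv mulrDl.
have e4 : \sum_p H i p * dt (gam p) = - \sum_p H i p * d p Rs.
  by rewrite -sumrN; apply: eq_bigr => p _; rewrite flow_chr_tr mulrN.
(* Only a contraction of dt(Gamma) is wanted, so [div_inv] is differentiated in time and the
   variation of the individual symbols is never computed. *)
have := congr1 dt (div_inv i).
rewrite /bet (der_sum ddt) (derB ddt) (derN ddt) (der_sum2M _ _ ddt).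
rewrite (der_sumM ddt) e1 e2 e3 e4 div_SH.
set X := \sum_j \sum_k H j k * _; set Y := \sum_q H i q * _.
set Z := \sum_p SH i p * _; set W := \sum_j \sum_p SH j p * _.
move=> /eqP; rewrite -subr_eq0.
rewrite (_ : _ - _ = X - (1 - (half + half)) * Y); last by ring.
by rewrite half2 subrr mul0r subr0 => /eqP.
Qed.

(** The variation of Ricci is the divergence of dt(Gamma) minus the gradient of its trace. After
    contraction with [H] the former vanishes by [trace_flow_chr], and the latter is the Laplacian of
    R, here in coordinates, by [flow_chr_tr]. The quadratic term 2|Ric|^2 comes from dt([H]). *)
Lemma scal_evol : dt Rs = \sum_i \sum_j (S i j * S j i + S i j * S j i)
  + \sum_j \sum_k H j k * d j (d k Rs)
  - \sum_p (\sum_j \sum_k H j k * C p j k) * d p Rs.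
Proof.
have ricE a b : dt (Ric a b) = \sum_i d i (dt (C i a b)) + d a (d b Rs)
   + \sum_i \sum_p (dt (C p a b) * C i i p + C p a b * dt (C i i p))
   - \sum_i \sum_p (dt (C p i b) * C i a p + C p i b * dt (C i a p)).
  have -> : Ric a b = \sum_i d i (C i a b) - d a (gam b)
      + \sum_i \sum_p C p a b * C i i p - \sum_i \sum_p C p i b * C i a p.
    rewrite /ric /curv big_split /= sumrB /chr_tr der_sum // -[RHS]addrA.
    by congr (_ + _); rewrite -sumrB; apply: eq_bigr => i _; rewrite sumrB.
  rewrite (derB ddt) 2!(derD ddt) (derN ddt) !(der_sum2M _ _ ddt) -!sum2D dtC.
  rewrite flow_chr_tr (derN (dd _)) opprK (der_sum ddt).
  by congr (_ + _ + _ - _); apply: eq_bigr => i _; rewrite dtC.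
rewrite RsE (der_sum2M _ _ ddt).
have -> : \sum_i \sum_j dt (H i j) * Ric i j
    = \sum_i \sum_j (S i j * S j i + S i j * S j i).
  apply: eq_bigr => i _; under eq_bigr do rewrite flow_inv mulrDl.
  have e : \sum_j SH i j * Ric i j = \sum_j S i j * S j i.
    under eq_bigr do rewrite mulr_suml.
    rewrite exchange_big; apply: eq_bigr => q _; rewrite [in RHS]/ricci_endo.
    by rewrite mulr_sumr; apply: eq_bigr => p _; rewrite mulrA.
  by rewrite !big_split /= e.
(* Differentiating [trace_flow_chr] moves [d i] from dt(Gamma) onto [H], where [dH] turns it into
   Christoffel products; these match one of the two groups of quadratic terms in [ricE]. *)
have e1 : \sum_a \sum_b H a b * \sum_i d i (dt (C i a b))
  = \sum_a \sum_b H a b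
       * (\sum_i \sum_p (dt (C p i b) * C i a p + C p i b * dt (C i a p))).
  have /eqP : \sum_i d i (\sum_a \sum_b H a b * dt (C i a b)) = 0.
    by rewrite big1 // => i _; rewrite trace_flow_chr der0.
  under eq_bigr do rewrite der_sum2M //.
  rewrite big_split /= addrC addr_eq0 => /eqP e.
  transitivity (\sum_i \sum_a \sum_b H a b * d i (dt (C i a b))).
    by rewrite sum3_rot; apply: eq_sum2 => a b; rewrite mulr_sumr.
  rewrite e -sumrN.
  transitivity (\sum_i \sum_a \sum_b \sum_p C a i p * H p b * dt (C i a b)
      + \sum_i \sum_a \sum_b \sum_p C b i p * H a p * dt (C i a b)).
    rewrite -sum2D; apply: eq_bigr => i _; rewrite -sumrN; apply: eq_bigr => a _.
    rewrite -big_split -sumrN; apply: eq_bigr => b _ /=.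
    rewrite dH mulNr opprK mulr_suml -big_split; apply: eq_bigr => p _ /=.
    by rewrite mulrDl.
  rewrite [RHS](eq_sum2 (fun a b => congr1 (fun z => H a b * z) (sum2D _ _))).
  under [RHS]eq_sum2 => a b do rewrite mulrDr !sum2M.
  rewrite [RHS]sum2D; congr (_ + _).
    rewrite sum4_swap exchange_big; apply: eq_sum2 => p b; rewrite exchange_big.
    by apply: eq_sum2 => a i; rewrite (Csym a i p); ring.
  rewrite exchange_big; apply: eq_bigr => a _; rewrite -[LHS]sum3_rot.
  by apply: eq_bigr => p _; apply: eq_sum2 => i b; ring.
have e3 (X : 'I_m -> 'I_m -> 'I_m -> A) (Y : 'I_m -> 'I_m -> A) :
    \sum_a \sum_b H a b * (\sum_i \sum_p X p a b * Y i p)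
    = \sum_p (\sum_a \sum_b H a b * X p a b) * (\sum_i Y i p).
  under eq_sum2 => a b do rewrite sum2M.
  rewrite sum4_swap exchange_big; apply: eq_bigr => p _; rewrite mulr_sumr.
  apply: eq_bigr => i _; rewrite mulrC sum2M; apply: eq_sum2 => a b; ring.
rewrite -addrA; congr (_ + _).
under eq_sum2 => a b do rewrite ricE mulrBr !mulrDr sum2D mulrDr.
rewrite !(sum2D, sum2N) e1 !e3.
(* The other group factors: one product contains the vanishing contraction of dt(Gamma), the other
   contains dt of the trace [gam], equal to minus the gradient of R. *)
rewrite [X in _ + (X + _) - _]big1 ?add0r; last first.
  by move=> p _; rewrite trace_flow_chr mul0r.
rewrite addrAC [X in X + _ = _]addrAC subrr add0r; congr (_ + _).
rewrite -sumrN; apply: eq_bigr => p _; rewrite -mulrN; congr (_ * _).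
by rewrite -flow_chr_tr der_sum.
Qed.
End RicciFlow.

(** * The soliton equation modulo u = 1/N *)

Section Soliton.
Variables (A : comPzRingType) (half : A) (n : nat) (D : 'I_n.+1 -> A -> A).
Hypothesis half2 : half + half = 1.
Hypothesis dD : forall i, derivation (D i).
Hypothesis DC : forall i j a, D i (D j a) = D j (D i a).
Variables (G H : 'I_n -> 'I_n -> A).
Hypothesis Gsym : forall i j, G i j = G j i.
Hypothesis HG : forall i j, \sum_p H i p * G p j = (i == j)%:R.

Local Notation d := (fun i : 'I_n => D (lift ord0 i)).
Local Notation dl i := (D (lift ord0 i)).
Local Notation dt := (D ord0).
Local Notation C := (chr d half G H).
Local Notation Ric := (ric d C).
Local Notation S := (ricci_endo d C H).
Local Notation Rs := (scal d C H).

Hypothesis flow : forall i j, dt (G i j) = - (Ric i j + Ric i j).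

Variables (t s u N w : A).
Hypothesis ts : t * s = 1.
Hypothesis Nu : N * u = 1.
Hypothesis Dt : forall i, D i t = (i == ord0)%:R.
Hypothesis DN : forall i, D i N = 0.
Hypothesis wE : (1 + u * (t ^+ 2 * Rs *+ 2 + n%:R * t)) * w = 1.

(** Stands for boundedness of all derivatives, uniformly in N on compact sets. It is assumed of [u]
    but not of [N], so a factor [N] has to meet a factor [u] before anything is estimated. *)
Variable ub : A -> Prop.
Hypothesis ub1 : ub 1.
Hypothesis ubN : forall a, ub a -> ub (- a).
Hypothesis ubD : forall a b, ub a -> ub b -> ub (a + b).
Hypothesis ubM : forall a b, ub a -> ub b -> ub (a * b).
Hypothesis ubd : forall i a, ub a -> ub (D i a).
Hypothesis ubhalf : ub half.
Hypothesis ubG : forall i j, ub (G i j).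
Hypothesis ubH : forall i j, ub (H i j).
Hypothesis ubt : ub t.
Hypothesis ubs : ub s.
Hypothesis ubu : ub u.
Hypothesis ubw : ub w.

Lemma ub0 : ub 0.
Proof. by rewrite -(subrr 1); apply: ubD => //; exact: ubN. Qed.

Lemma ub_nat k : ub k%:R.
Proof. by elim: k => [|k IH]; [exact: ub0 | rewrite -natr1; exact: ubD]. Qed.

Lemma ub_sum (I : finType) (F : I -> A) :
  (forall i, ub (F i)) -> ub (\sum_i F i).
Proof. by move=> uF; elim/big_ind: _ => //; exact: ub0. Qed.

(** Only the error [e] is bounded: [x] and [y] may contain terms of order N. Multiplication
    therefore asks for bounded limits in [moduM]. *)
Definition modu (x y : A) : Prop := exists2 e, ub e & x = y + u * e.

Let Du i : D i u = 0.
Proof. by rewrite (derV (dD i) Nu) DN mulr0 oppr0. Qed.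

Lemma modu_refl x : modu x x.
Proof. by exists 0; [exact: ub0 | rewrite mulr0 addr0]. Qed.

Lemma moduD x y x' y' : modu x y -> modu x' y' -> modu (x + x') (y + y').
Proof.
by move=> [e ue ->] [f uf ->]; exists (e + f); [exact: ubD | ring].
Qed.

Lemma moduN x y : modu x y -> modu (- x) (- y).
Proof. by move=> [e ue ->]; exists (- e); [exact: ubN | ring]. Qed.

Lemma moduM x y x' y' :
  ub y -> ub y' -> modu x y -> modu x' y' -> modu (x * x') (y * y').
Proof.
move=> uy uy' [e ue ->] [f uf ->]; exists (e * y' + y * f + u * e * f).
  by apply: ubD; [apply: ubD; exact: ubM | do !apply: ubM].
by ring.
Qed.

Lemma modu_der i x y : modu x y -> modu (D i x) (D i y).
Proof.
move=> [e ue ->]; exists (D i e); first exact: ubd.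
by rewrite derD // derM // Du mul0r add0r.
Qed.

Lemma modu_sum (I : finType) (F F' : I -> A) :
  (forall i, modu (F i) (F' i)) -> modu (\sum_i F i) (\sum_i F' i).
Proof.
move=> h; elim/big_rec2: _ => [|i y1 y2 _]; first exact: modu_refl.
exact: moduD.
Qed.

Lemma modu_ub x y : ub y -> modu x y -> ub x.
Proof. by move=> uy [e ue ->]; apply: ubD => //; exact: ubM. Qed.

Lemma ub_ric m (f : 'I_m -> 'I_n.+1) (K : 'I_m -> 'I_m -> 'I_m -> A) j k :
  (forall l i j, ub (K l i j)) -> ub (ric (fun i => D (f i)) K j k).
Proof.
move=> uK; apply: ub_sum => i; apply: ubD; first apply: ubD.
- exact: ubd.
- by apply: ubN; exact: ubd.
- by apply: ub_sum => p; apply: ubD; [|apply: ubN]; exact: ubM.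
Qed.

Lemma modu_ric (K K' : 'I_n.+1 -> 'I_n.+1 -> 'I_n.+1 -> A) j k :
  (forall l i j, ub (K' l i j)) ->
  (forall l i j, modu (K l i j) (K' l i j)) ->
  modu (ric D K j k) (ric D K' j k).
Proof.
move=> uK e; apply: modu_sum => i; apply: moduD; first apply: moduD.
- exact: modu_der.
- by apply: moduN; exact: modu_der.
- by apply: modu_sum => p; apply: moduD; [|apply: moduN]; exact: moduM.
Qed.

Let ubC l i j : ub (C l i j).
Proof.
apply: ubM => //; apply: ub_sum => p; apply: ubM => //.
by apply: ubD; [apply: ubD | apply: ubN]; exact: ubd.
Qed.
Let ubRic j k : ub (Ric j k). Proof. exact: ub_ric. Qed.
Let ubS l a : ub (S l a).
Proof. by apply: ub_sum => p; exact: ubM. Qed.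
Let ubR : ub Rs. Proof. exact: ub_sum. Qed.

Let dd i : derivation (dl i). Proof. exact: dD. Qed.
Let dC i j a : dl i (dl j a) = dl j (dl i a). Proof. exact: DC. Qed.
Let dtC i a : dt (dl i a) = dl i (dt a). Proof. exact: DC. Qed.
Let Hsym := inv_sym Gsym HG.
Let Csym := chr_sym half d H Gsym.
Let Rsym := ric_sym half2 dd dC Gsym HG.
Let dH := chr_compat_inv half2 dd Gsym HG.

Let Dhalf i : D i half = 0.
Proof.
have := der1 (dD i); rewrite -half2 derD // => e.
by rewrite -[LHS]mul1r -half2 mulrDl -mulrDr e mulr0.
Qed.

Let Ds i : D i s = - (s ^+ 2 * (i == ord0)%:R).
Proof. by rewrite (derV (dD i) ts) Dt expr2. Qed.
Let dts : dt s = - s ^+ 2. Proof. by rewrite Ds eqxx mulr1. Qed.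
Let dis i : dl i s = 0.
Proof. by rewrite Ds eq_sym (negPf (neq_lift _ _)) mulr0 oppr0. Qed.

Definition check_lapse : A :=
  half * (N * s ^+ 3) + Rs * s + half * (n%:R * s ^+ 2).
Definition check_lapse_inv : A := (u + u) * t ^+ 3 * w.

Lemma check_lapseK : check_lapse_inv * check_lapse = 1.
Proof.
rewrite /check_lapse /check_lapse_inv.
have ts2 : t ^+ 2 * s ^+ 2 = 1 by rewrite -exprMn ts expr1n.
have ts3 : t ^+ 3 * s ^+ 3 = 1 by rewrite -exprMn ts expr1n.
transitivity (w * ((half + half) * (N * u) * (t ^+ 3 * s ^+ 3)
   + u * (t ^+ 2 * Rs *+ 2 * (t * s)
          + (half + half) * n%:R * t * (t ^+ 2 * s ^+ 2)))).
  by ring.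
by rewrite half2 Nu ts ts2 ts3 !mul1r !mulr1 mulrC.
Qed.

Definition check_G (i j : 'I_n.+1) : A :=
  match unlift ord0 i, unlift ord0 j with
  | Some a, Some b => G a b * s
  | None, None => check_lapse
  | _, _ => 0
  end.
Definition check_H (i j : 'I_n.+1) : A :=
  match unlift ord0 i, unlift ord0 j with
  | Some a, Some b => H a b * t
  | None, None => check_lapse_inv
  | _, _ => 0
  end.

Local Notation Cc := (chr D half check_G check_H).

Lemma check_G_sym i j : check_G i j = check_G j i.
Proof.
rewrite /check_G; case: unliftP => [a|] _; case: unliftP => [b|] _ //.
by rewrite Gsym.
Qed.

Lemma check_HG i j : \sum_p check_H i p * check_G p j = (i == j)%:R.
Proof.
rewrite big_ord_recl /check_G /check_H unlift_none.
under eq_bigr do rewrite liftK.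
case: (unliftP ord0 i) => [a|] ->; case: (unliftP ord0 j) => [b|] ->.
- rewrite mul0r add0r (inj_eq lift_inj) -HG.
  by apply: eq_bigr => p _; rewrite mulrACA ts mulr1.
- rewrite mul0r add0r big1 => [|p _]; last by rewrite mulr0.
  by rewrite eq_sym (negPf (neq_lift _ _)).
- rewrite mulr0 add0r big1 => [|p _]; last by rewrite mul0r.
  by rewrite (negPf (neq_lift _ _)).
- by rewrite check_lapseK big1 ?addr0 ?eqxx // => p _; rewrite mul0r.
Qed.

(* The limit of the Christoffel symbols as N tends to infinity. *)
Definition lim_chr (l i j : 'I_n.+1) : A :=
  match unlift ord0 l, unlift ord0 i, unlift ord0 j with
  | Some l, Some i, Some j => C l i j
  | Some l, Some i, None | Some l, None, Some i =>
      - S l i - half * s * (l == i)%:R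
  | Some l, None, None => - (half * \sum_p H l p * dl p Rs)
  | None, None, None => - (half *+ 3 * s)
  | None, _, _ => 0
  end.

Let Gss a b : check_G (lift ord0 a) (lift ord0 b) = G a b * s.
Proof. by rewrite /check_G !liftK. Qed.
Let Gs0 a : check_G (lift ord0 a) ord0 = 0.
Proof. by rewrite /check_G unlift_none liftK. Qed.
Let G0s a : check_G ord0 (lift ord0 a) = 0.
Proof. by rewrite /check_G unlift_none liftK. Qed.
Let G00 : check_G ord0 ord0 = check_lapse.
Proof. by rewrite /check_G unlift_none. Qed.

Let CsE l i j : Cc (lift ord0 l) i j
  = half * (t * \sum_p H l p * (D i (check_G j (lift ord0 p))
      + D j (check_G i (lift ord0 p)) - dl p (check_G i j))).
Proof.
rewrite /chr big_ord_recl [check_H _ ord0]/check_H unlift_none liftK mul0r add0r.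
congr (_ * _); rewrite mulr_sumr; apply: eq_bigr => p _.
by rewrite /check_H !liftK; ring.
Qed.

Let C0E i j : Cc ord0 i j
  = half * (check_lapse_inv * (D i (check_G j ord0) + D j (check_G i ord0)
      - dt (check_G i j))).
Proof.
rewrite /chr big_ord_recl [check_H _ ord0]/check_H unlift_none.
rewrite [X in _ + X]big1 ?addr0 // => p _.
by rewrite /check_H unlift_none liftK mul0r.
Qed.

Let dbl x : half * (x + x) = x.
Proof. by rewrite -[RHS]mul1r -half2; ring. Qed.

Let Csss l i j : Cc (lift ord0 l) (lift ord0 i) (lift ord0 j) = C l i j.
Proof.
rewrite CsE !Gss /chr; congr (_ * _); rewrite mulr_sumr.
apply: eq_bigr => p _; rewrite !Gss !(derM (dD _)) !dis -[RHS]mul1r -ts; ring.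
Qed.

Let Css0 l i : Cc (lift ord0 l) (lift ord0 i) ord0
  = - S l i - half * s * (l == i)%:R.
Proof.
have -> : (l == i)%:R = \sum_p H l p * G i p :> A.
  by rewrite -HG; apply: eq_bigr => p _; rewrite Gsym.
rewrite CsE /ricci_endo -sumrN !mulr_sumr -sumrB.
apply: eq_bigr => p _; rewrite Gss Gs0 G0s !(der0 (dD _)) (derM (dD _)) dts flow.
transitivity (- (half + half) * (t * s) * (H l p * Ric i p)
   - half * (t * s) * s * (H l p * G i p)); first by ring.
by rewrite ts half2; ring.
Qed.

Let Cs00 l : Cc (lift ord0 l) ord0 ord0 = - (half * \sum_p H l p * dl p Rs).
Proof.
have dF p : dl p check_lapse = dl p Rs * s.
  rewrite /check_lapse !(derD (dD _)) !(derM (dD _)) !exprS ?(derM (dD _)).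
  by rewrite !dis !DN !Dhalf (der_nat (dD _)); ring.
rewrite CsE -mulrN -sumrN mulr_sumr; congr (_ * _).
apply: eq_bigr => p _; rewrite G0s G00 dF !(der0 (dD _)).
transitivity ((t * s) * - (H l p * dl p Rs)); first by ring.
by rewrite ts mul1r.
Qed.

(** Here the factor N of the potential meets the factor u of the inverse lapse, and the result is
    bounded. *)
Let half_inv : N * (half * check_lapse_inv) = t ^+ 3 * w.
Proof.
rewrite /check_lapse_inv.
transitivity ((half + half) * (N * u) * (t ^+ 3 * w)); first by ring.
by rewrite half2 Nu !mul1r.
Qed.

Let wmod : w = 1 - u * ((t ^+ 2 * Rs *+ 2 + n%:R * t) * w).
Proof.
have -> : u * ((t ^+ 2 * Rs *+ 2 + n%:R * t) * w)
  = (1 + u * (t ^+ 2 * Rs *+ 2 + n%:R * t)) * w - w by ring.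
by rewrite wE; ring.
Qed.

Let L_sss l i j : lim_chr (lift ord0 l) (lift ord0 i) (lift ord0 j) = C l i j.
Proof. by rewrite /lim_chr !liftK. Qed.
Let L_ss0 l i : lim_chr (lift ord0 l) (lift ord0 i) ord0
  = - S l i - half * s * (l == i)%:R.
Proof. by rewrite /lim_chr !liftK unlift_none. Qed.
Let L_s0s l i : lim_chr (lift ord0 l) ord0 (lift ord0 i)
  = - S l i - half * s * (l == i)%:R.
Proof. by rewrite /lim_chr !liftK unlift_none. Qed.
Let L_s00 l : lim_chr (lift ord0 l) ord0 ord0
  = - (half * \sum_p H l p * dl p Rs).
Proof. by rewrite /lim_chr !liftK unlift_none. Qed.
Let L_0ss i j : lim_chr ord0 (lift ord0 i) (lift ord0 j) = 0.
Proof. by rewrite /lim_chr unlift_none !liftK. Qed.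
Let L_0s0 i : lim_chr ord0 (lift ord0 i) ord0 = 0.
Proof. by rewrite /lim_chr unlift_none liftK. Qed.
Let L_00s i : lim_chr ord0 ord0 (lift ord0 i) = 0.
Proof. by rewrite /lim_chr unlift_none liftK. Qed.
Let L_000 : lim_chr ord0 ord0 ord0 = - (half *+ 3 * s).
Proof. by rewrite /lim_chr unlift_none. Qed.
Let LE := (L_sss, L_ss0, L_s0s, L_s00, L_0ss, L_0s0, L_00s, L_000).

Let Cc_sym l i j : Cc l i j = Cc l j i.
Proof. exact: (chr_sym half D check_H check_G_sym). Qed.

Let C0ss i j : Cc ord0 (lift ord0 i) (lift ord0 j)
  = half * (check_lapse_inv * ((Ric i j + Ric i j) * s + G i j * s ^+ 2)).
Proof.
rewrite C0E !Gs0 Gss !(der0 (dD _)) (derM (dD _)) flow dts.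
by congr (_ * (_ * _)); ring.
Qed.

Let C0s0 i : Cc ord0 (lift ord0 i) ord0
  = half * (check_lapse_inv * (dl i Rs * s)).
Proof.
have dF : dl i check_lapse = dl i Rs * s.
  rewrite /check_lapse !(derD (dD _)) !(derM (dD _)) !exprS ?(derM (dD _)).
  by rewrite !dis !DN !Dhalf (der_nat (dD _)); ring.
by rewrite C0E Gs0 G00 dF !(der0 (dD _)) addr0 subr0.
Qed.

Let C000 : Cc ord0 ord0 ord0
  = half * (check_lapse_inv * (- (half *+ 3 * (N * s ^+ 4))
     + (dt Rs * s - Rs * s ^+ 2) - n%:R * s ^+ 3)).
Proof.
have dF : dt check_lapse = - (half *+ 3 * (N * s ^+ 4))
     + (dt Rs * s - Rs * s ^+ 2) - n%:R * s ^+ 3.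
  rewrite /check_lapse !(derD (dD _)) !(derM (dD _)) !exprS ?(derM (dD _)).
  rewrite !dts !DN !Dhalf (der_nat (dD _)) -[in RHS](dbl (n%:R * _)); ring.
by rewrite C0E G00 dF addrK.
Qed.

Let ub_lim l i j : ub (lim_chr l i j).
Proof.
rewrite /lim_chr; case: (unlift ord0 l) => [l'|];
  case: (unlift ord0 i) => [i'|]; case: (unlift ord0 j) => [j'|];
  rewrite ?mulrSr; try exact: ub0; try exact: ubC.
- by apply: ubD; apply: ubN => //; do !apply: ubM => //; exact: ub_nat.
- by apply: ubD; apply: ubN => //; do !apply: ubM => //; exact: ub_nat.
- apply: ubN; apply: ubM => //; apply: ub_sum => p; apply: ubM => //.
  exact: ubd.
- by apply: ubN; apply: ubM => //; do !apply: ubD => //; exact: ub0.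
Qed.

Let half_invu : half * check_lapse_inv = u * (t ^+ 3 * w).
Proof. by rewrite -half_inv mulrA [u * N]mulrC Nu mul1r. Qed.

Let modu0 e : ub e -> modu (u * e) 0.
Proof. by move=> ue; exists e; rewrite ?add0r. Qed.

Let ub_pow a k : ub a -> ub (a ^+ k).
Proof. by move=> ua; elim: k => [|k IH] //; rewrite exprS; exact: ubM. Qed.

(** The metric is block diagonal. With a spatial upper index the lapse is never inverted and its
    order N part, depending on t alone, has no spatial derivative, so the limit is exact. With upper
    index 0 there is a factor u, compensated only in Gamma^0_{00}, where the t-derivative of
    N/(2t^3) leaves -3/(2t). *)
Lemma modu_check_chr l i j : modu (Cc l i j) (lim_chr l i j).
Proof.
case: (unliftP ord0 l) => [l'|] ->; case: (unliftP ord0 i) => [i'|] ->;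
  case: (unliftP ord0 j) => [j'|] ->; rewrite ?LE.
- rewrite Csss; exact: modu_refl.
- rewrite Css0; exact: modu_refl.
- rewrite Cc_sym Css0; exact: modu_refl.
- rewrite Cs00; exact: modu_refl.
- rewrite C0ss mulrA half_invu -mulrA; apply: modu0.
  do ?[apply: ubM | apply: ubD | apply: ub_pow] => //.
- rewrite C0s0 mulrA half_invu -mulrA; apply: modu0.
  do ?[apply: ubM | apply: ubD | apply: ub_pow] => //; exact: ubd.
- rewrite Cc_sym C0s0 mulrA half_invu -mulrA; apply: modu0.
  do ?[apply: ubM | apply: ubD | apply: ub_pow] => //; exact: ubd.
- rewrite C000.
  have -> : half * (check_lapse_inv * (- (half *+ 3 * (N * s ^+ 4))
     + (dt Rs * s - Rs * s ^+ 2) - n%:R * s ^+ 3))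
    = - (N * (half * check_lapse_inv) * (half *+ 3 * s ^+ 4))
      + (half * check_lapse_inv) * (dt Rs * s - Rs * s ^+ 2 - n%:R * s ^+ 3).
    by ring.
  rewrite half_inv half_invu {1}wmod.
  have ts3 : t ^+ 3 * s ^+ 4 = s by rewrite [s ^+ 4]exprS mulrCA -exprMn ts expr1n mulr1.
  have -> : - (half *+ 3 * s) = - (half *+ 3 * (t ^+ 3 * s ^+ 4)) by rewrite ts3.
  set b := _ + n%:R * t; set c := dt Rs * s - _ - _.
  exists (t ^+ 3 * (b * w) * (half *+ 3 * s ^+ 4) + t ^+ 3 * w * c); last by ring.
  rewrite /b /c ?mulrSr.
  do ?[apply: ubM | apply: ubD | apply: ubN | apply: ub_pow | exact: ub_nat
    | exact: ub0 | exact: ubd] => //.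
Qed.

Let B l i := - S l i - half * s * (l == i)%:R.
Let K l := - (half * \sum_p H l p * dl p Rs).
Let LB : (forall l i, lim_chr (lift ord0 l) (lift ord0 i) ord0 = B l i)
  * (forall l i, lim_chr (lift ord0 l) ord0 (lift ord0 i) = B l i)
  * (forall l, lim_chr (lift ord0 l) ord0 ord0 = K l).
Proof. by do ?split => *; rewrite LE. Qed.

(** The time slices are totally geodesic for the limit connection, Gamma^0_{ij} = 0, so no term with
    a summation index 0 survives. *)
Let ric_lim_ss j k : ric D lim_chr (lift ord0 j) (lift ord0 k) = Ric j k.
Proof.
rewrite /ric big_ord_recl {1}/curv big_ord_recl big1 => [|p _].
  rewrite !LE !(der0 (dD _)) !mul0r !subrr !add0r.
  apply: eq_bigr => i _; rewrite /curv big_ord_recl !LE !mul0r subrr add0r.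
  by congr (_ + _); apply: eq_bigr => p _; rewrite !LE.
by rewrite !LE; ring.
Qed.

(** The spatial part of Gamma^l_{i0} is -Ric^l_i minus a multiple of the identity. The latter drops
    out by symmetry of the spatial symbols; the former contributes dR - div Ric, which is dR/2 by
    the contracted Bianchi identity. *)
Let ric_lim_s0 a : ric D lim_chr (lift ord0 a) ord0 = half * dl a Rs.
Proof.
rewrite /ric big_ord_recl {1}/curv big_ord_recl big1 => [|p _]; last first.
  by rewrite !LE; ring.
rewrite !LE (der0 (dD _)) (derN (dD _)) mulrSr mulr2n.
rewrite (derM (dD _)) !(derD (dD _)) dis Dhalf.
rewrite !(mul0r, mulr0, addr0, add0r, oppr0).
transitivity (\sum_i (dl i (B i a) - dl a (B i i))
    + \sum_i \sum_p (B p a * C i i p - B p i * C i a p)).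
  rewrite -big_split; apply: eq_bigr => i _.
  rewrite /curv big_ord_recl !LE !mul0r subr0 add0r; congr (_ + _).
  by apply: eq_bigr => p _; rewrite !LE.
have dB l i j : dl j (B l i) = - dl j (S l i).
  rewrite /B (derB (dD _)) (derN (dD _)) !(derM (dD _)) dis Dhalf.
  by rewrite (der_nat (dD _)); ring.
have e1 : \sum_i (dl i (B i a) - dl a (B i i))
    = dl a Rs - \sum_i dl i (S i a).
  rewrite sumrB addrC; congr (_ + _).
    by rewrite /scal (der_sum (dD _)) -sumrN; apply: eq_bigr => i _; rewrite dB opprK.
  by rewrite -sumrN; apply: eq_bigr => i _.
have e2 : \sum_i \sum_p (B p a * C i i p - B p i * C i a p)
   = \sum_i \sum_p C i a p * S p i - \sum_p chr_tr C p * S p a.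
  transitivity (\sum_i \sum_p C i a p * S p i - \sum_i \sum_p C i i p * S p a
     - half * s * (\sum_i \sum_p (a == p)%:R * C i i p
        - \sum_i \sum_p (i == p)%:R * C i a p)).
    rewrite -sum2N -sum2D -[in RHS]sum2N -[in RHS]sum2D sum2M -sum2N -sum2D.
    apply: eq_sum2 => i p.
    by rewrite /B (eq_sym p a) (eq_sym p i); ring.
  have -> : \sum_i \sum_p (a == p)%:R * C i i p
      = \sum_i \sum_p (i == p)%:R * C i a p.
    by apply: eq_bigr => i _; rewrite !sum_delta Csym.
  rewrite subrr mulr0 subr0; congr (_ - _); rewrite exchange_big.
  by apply: eq_bigr => p _; rewrite mulr_suml.
rewrite e1 e2.
have := contracted_bianchi half2 dd dC Csym Hsym dH a.
rewrite /= => e; rewrite -[in LHS](dbl (dl a Rs)) mulrDr -{1}e; ring.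
Qed.

(** The divergence of [K] and the square of [B] give -(Delta R)/2 - |Ric|^2, which is -(dR/dt)/2 by
    [scal_evol], while the trace of dt([B]) adds dR/dt. The coefficients of R/t add up to 3/2 - 1 =
    1/2, and those of n/t^2 to -1/2 + 3/4 - 1/4 = 0. *)
Let ric_lim_00 : ric D lim_chr ord0 ord0 = half * (s * Rs + dt Rs).
Proof.
rewrite /ric big_ord_recl {1}/curv [X in _ + X + _]big1 => [|p _]; last first.
  by rewrite subrr.
rewrite subrr !add0r.
transitivity (\sum_i dl i (K i) - \sum_i dt (B i i)
    - half *+ 3 * s * (\sum_i B i i)
    + (\sum_p K p * chr_tr C p - \sum_i \sum_p B p i * B i p)).
  have -> : \sum_p K p * chr_tr C p = \sum_i \sum_p K p * C i i p.
    by rewrite exchange_big; apply: eq_bigr => p _; rewrite mulr_sumr.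
  rewrite -sum2N -sum2D mulr_sumr -sumrB -sumrB -big_split.
  apply: eq_bigr => i _; rewrite /curv big_ord_recl !LB !LE !mul0r subr0 mulNr.
  rewrite addrA; congr (_ + _); apply: eq_bigr => p _.
  by rewrite !LB LE.
have sB : \sum_i B i i = - Rs - half * s * n%:R.
  rewrite sumrB sumrN -mulr_sumr; congr (_ - _ * _).
  by under eq_bigr do rewrite eqxx; rewrite sumr_const card_ord.
have sdB : \sum_i dt (B i i) = - dt Rs + half * s ^+ 2 * n%:R.
  rewrite -der_sum // sB (derB (dD _)) (derN (dD _)) !(derM (dD _)) dts Dhalf.
  by rewrite (der_nat (dD _)); ring.
have sBB : \sum_i \sum_p B p i * B i p = \sum_i \sum_j S i j * S j i
    + s * Rs + half * half * s ^+ 2 * n%:R.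
  have sd (X : 'I_n -> 'I_n -> A) :
      \sum_i \sum_p (i == p)%:R * X i p = \sum_i X i i.
    by apply: eq_bigr => i _; rewrite sum_delta.
  transitivity (\sum_i \sum_p S i p * S p i
     + half * s * (\sum_i \sum_p (i == p)%:R * S i p)
     + half * s * (\sum_i \sum_p (i == p)%:R * S p i)
     + half * half * s ^+ 2 * (\sum_(i < n) \sum_(p < n) (i == p)%:R * (i == p)%:R)).
    rewrite !sum2M -!sum2D; apply: eq_sum2 => i p.
    by rewrite /B (eq_sym p i); ring.
  rewrite !sd -/(scal _ _ _).
  under [X in _ + _ * X]eq_bigr do rewrite eqxx.
  rewrite sumr_const card_ord -(addrA (\sum_i _)); congr (_ + _ + _).
  by rewrite -[in RHS](dbl (s * Rs)); ring.
pose bet p := \sum_j \sum_k H j k * C p j k.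
(* The divergence of the vector field [K], which is -1/2 times the gradient of R; hence -1/2 times
   its Laplacian. *)
have sK : \sum_i dl i (K i) + \sum_p K p * chr_tr C p
   = half * (\sum_p bet p * dl p Rs)
     - half * (\sum_j \sum_k H j k * dl j (dl k Rs)).
  have -> : \sum_i dl i (K i)
      = - (half * (\sum_p (\sum_i dl i (H p i)) * dl p Rs
          + \sum_j \sum_k H j k * dl j (dl k Rs))).
    have -> : \sum_p (\sum_i dl i (H p i)) * dl p Rs
        = \sum_i \sum_p dl i (H i p) * dl p Rs.
      rewrite exchange_big; apply: eq_bigr => p _; rewrite mulr_suml.
      by apply: eq_bigr => i _; rewrite Hsym.
    rewrite -sum2D sum2M -sum2N; apply: eq_bigr => i _.
    rewrite /K (derN (dD _)) (derM (dD _)) Dhalf mul0r add0r (der_sum (dD _)).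
    rewrite mulr_sumr -sumrN; apply: eq_bigr => p _.
    by rewrite (derM (dD _)).
  have -> : \sum_p K p * chr_tr C p
      = half * \sum_p (- \sum_q H p q * chr_tr C q) * dl p Rs.
    have -> : \sum_p (- \sum_q H p q * chr_tr C q) * dl p Rs
       = - \sum_p \sum_q H p q * dl q Rs * chr_tr C p.
      rewrite exchange_big -sumrN; apply: eq_bigr => p _.
      rewrite mulNr mulr_suml; congr (- _); apply: eq_bigr => q _.
      by rewrite Hsym; ring.
    rewrite mulrN mulr_sumr -sumrN; apply: eq_bigr => p _.
    by rewrite /K mulNr -mulrA mulr_suml.
  have -> : \sum_p (\sum_i dl i (H p i)) * dl p Rs
    = - (\sum_p bet p * dl p Rs)
      + \sum_p (- \sum_q H p q * chr_tr C q) * dl p Rs.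
    rewrite -sumrN -big_split; apply: eq_bigr => p _ /=.
    by rewrite (div_inv half2 dd Gsym HG) mulrDl !mulNr.
  by ring.
have ev := scal_evol half2 dd (dD ord0) dC dtC Gsym HG flow.
rewrite /= sum2D -/(scal _ _ _) in ev.
transitivity ((\sum_i dl i (K i) + \sum_p K p * chr_tr C p)
  - \sum_i dt (B i i) - half *+ 3 * s * (\sum_i B i i)
  - \sum_i \sum_p B p i * B i p); first by ring.
rewrite sK sdB sB sBB.
rewrite -/bet in ev.
move: ev; set X := \sum_i \sum_j _; set Y := \sum_j \sum_k _.
set Z := \sum_p _ => ev.
have -> : X = half * (dt Rs - Y + Z) by rewrite ev -[LHS]dbl; congr (_ * _); ring.
apply/eqP; rewrite -subr_eq0; apply/eqP.
transitivity ((1 - (half + half)) * (dt Rs - s * Rs - half * s ^+ 2 * n%:R)).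
  by ring.
by rewrite half2 subrr mul0r.
Qed.

Let f := - (half * N * s).
Let Hess i j := D i (D j f) - \sum_l Cc l i j * D l f.

Definition alg_soliton_error (i j : 'I_n.+1) : A :=
  ric D Cc i j + (D i (D j (- (half * N * s)))
    - \sum_l Cc l i j * D l (- (half * N * s))) + half * check_G i j.

Let dtf : dt f = half * N * s ^+ 2.
Proof. by rewrite /f (derN (dD _)) !(derM (dD _)) dts DN Dhalf; ring. Qed.
Let dlf i : dl i f = 0.
Proof. by rewrite /f (derN (dD _)) !(derM (dD _)) dis DN Dhalf; ring. Qed.

Let HessE i j : Hess i j = D i (D j f) - Cc ord0 i j * (half * N * s ^+ 2).
Proof.
rewrite /Hess big_ord_recl dtf big1 ?addr0 // => l _.
by rewrite dlf mulr0.
Qed.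

Let HessC i j : Hess i j = Hess j i.
Proof. by rewrite !HessE DC Cc_sym. Qed.

Let errC i j : alg_soliton_error i j = alg_soliton_error j i.
Proof.
rewrite /alg_soliton_error check_G_sym.
rewrite (ric_sym half2 dD DC check_G_sym check_HG).
by rewrite -/f -/(Hess _ _) HessC.
Qed.

Let t2s2 : t ^+ 2 * s ^+ 2 = 1. Proof. by rewrite -exprMn ts expr1n. Qed.
Let t3s3 : t ^+ 3 * s ^+ 3 = 1. Proof. by rewrite -exprMn ts expr1n. Qed.

Let wmodu : modu w 1.
Proof.
exists (- ((t ^+ 2 * Rs *+ 2 + n%:R * t) * w)); last by rewrite {1}wmod; ring.
apply: ubN; do ?[apply: ubM | apply: ubD | apply: ub_pow | exact: ub_nat] => //.
Qed.

Let dtf2 : D ord0 (D ord0 f) = - (N * s ^+ 3).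
Proof.
rewrite dtf !(derM (dD _)) ?(derM (dD _)) dts DN Dhalf.
by rewrite -[in RHS](dbl (N * _)); ring.
Qed.

(** The potential depends on t alone, so its Hessian involves only the symbols with upper index 0,
    taken in their exact form. Once [half_inv] has absorbed one N, the Christoffel term is a
    coefficient times [w]; where the coefficient is bounded, [msd] replaces [w] by 1. *)
Theorem modu_soliton_error i j : modu (alg_soliton_error i j) 0.
Proof.
have mric i' j' : modu (ric D Cc i' j') (ric D lim_chr i' j').
  by apply: modu_ric => *; [exact: ub_lim | exact: modu_check_chr].
have main i' j' y : modu (Hess i' j' + half * check_G i' j') y ->
    ric D lim_chr i' j' + y = 0 -> modu (alg_soliton_error i' j') 0.
  by move=> h <-; rewrite /alg_soliton_error -addrA; exact: moduD.
have msd b : ub b -> modu (- (b * w)) (- b).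
  move=> ub_b; apply: moduN; rewrite -[X in modu _ X]mulr1.
  by apply: moduM => //; exact: modu_refl.
have s0 a : modu (alg_soliton_error (lift ord0 a) ord0) 0.
  apply: main (_ : modu _ (- (half * dl a Rs))) _; last by rewrite ric_lim_s0 subrr.
  rewrite Gs0 mulr0 addr0 HessE dtf C0s0.
  have -> : D (lift ord0 a) (half * N * s ^+ 2) = 0.
    by rewrite !(derM (dD _)) DN Dhalf dis; ring.
  rewrite sub0r.
  have -> : half * (check_lapse_inv * (dl a Rs * s)) * (half * N * s ^+ 2)
    = half * dl a Rs * (s ^+ 3) * (N * (half * check_lapse_inv)) by ring.
  rewrite half_inv.
  have -> : half * dl a Rs * s ^+ 3 * (t ^+ 3 * w)
    = t ^+ 3 * s ^+ 3 * (half * dl a Rs * w) by ring.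
  by rewrite t3s3 mul1r; apply: msd => //; apply: ubM => //; exact: ubd.
case: (unliftP ord0 i) => [a|] ->; case: (unliftP ord0 j) => [b|] ->.
- apply: main (_ : modu _ (- Ric a b)) _; last by rewrite ric_lim_ss subrr.
  rewrite Gss HessE dlf (der0 (dD _)) sub0r C0ss.
  have -> : half * (check_lapse_inv * ((Ric a b + Ric a b) * s + G a b * s ^+ 2))
      * (half * N * s ^+ 2)
    = ((half + half) * Ric a b * s ^+ 3 + half * G a b * s ^+ 4)
      * (N * (half * check_lapse_inv)) by ring.
  rewrite half_inv half2 mul1r.
  have -> : (Ric a b * s ^+ 3 + half * G a b * s ^+ 4) * (t ^+ 3 * w)
    = t ^+ 3 * s ^+ 3 * (Ric a b + half * G a b * s) * w by ring.
  rewrite t3s3 mul1r.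
  have -> : - Ric a b = - (Ric a b + half * G a b * s) + half * (G a b * s) by ring.
  apply: moduD; last exact: modu_refl.
  by apply: msd => //; apply: ubD => //; do !apply: ubM => //.
- exact: s0.
- by rewrite errC; exact: s0.
- apply: main (_ : modu _ (- (half * (s * Rs + dt Rs)))) _; last first.
    by rewrite ric_lim_00 subrr.
  rewrite G00 HessE dtf2 C000 /check_lapse.
  pose b := t ^+ 2 * Rs *+ 2 + n%:R * t.
  (* The correction [b * w] has order one: through it the terms R/t and n/(2t^2) of the lapse enter
     the limit. *)
  have Nw : N * w = N - b * w.
    rewrite {1}wmod -/b; transitivity (N - (N * u) * (b * w)); first by ring.
    by rewrite Nu mul1r.
  have s3b : s ^+ 3 * b = Rs * s *+ 2 + n%:R * s ^+ 2.
    transitivity ((t ^+ 2 * s ^+ 2) * (Rs * s *+ 2) + (t * s) * n%:R * s ^+ 2).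
      by rewrite /b; ring.
    by rewrite t2s2 ts !mul1r.
  pose q := half * half *+ 3 * (Rs * s *+ 2 + n%:R * s ^+ 2)
    + half * (dt Rs - Rs * s - n%:R * s ^+ 2).
  set x := (X in modu X _).
  have -> : x = - (q * w) + (half * (Rs * s) + half * half * (n%:R * s ^+ 2)).
    (* The terms of order N: -1 from the second derivative of the potential, 3/4 from Gamma^0_{00},
       and 1/4 from half the lapse. *)
    have -> : x = (half * half *+ 4 - 1) * (N * s ^+ 3)
        + (half * half *+ 3 * (t ^+ 3 * s ^+ 3 * N * w - N) * s ^+ 3
           - half * (t ^+ 3 * s ^+ 3) * (dt Rs - Rs * s - n%:R * s ^+ 2) * w)
        + (half * (Rs * s) + half * half * (n%:R * s ^+ 2)).
      have -> : x = - (N * s ^+ 3) - (N * (half * check_lapse_inv))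
           * (half * s ^+ 2 * (- (half *+ 3 * (N * s ^+ 4))
                + (dt Rs * s - Rs * s ^+ 2) - n%:R * s ^+ 3))
        + half * (half * (N * s ^+ 3) + Rs * s + half * (n%:R * s ^+ 2)).
        by rewrite /x; ring.
      by rewrite half_inv; ring.
    rewrite t3s3 mul1r mulr1 Nw /q -s3b.
    have -> : half * half *+ 4 = 1.
      transitivity ((half + half) * (half + half)); first by ring.
      by rewrite half2 mulr1.
    by ring.
  have -> : - (half * (s * Rs + dt Rs))
      = - q + (half * (Rs * s) + half * half * (n%:R * s ^+ 2)).
    apply/eqP; rewrite -subr_eq0; apply/eqP; rewrite /q.
    transitivity ((half + half - 1) * (half * n%:R * s ^+ 2 + half *+ 3 * Rs * s)).
      by ring.
    by rewrite half2 subrr mul0r.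
  apply: moduD; last exact: modu_refl.
  apply: msd => //; rewrite /q ?mulrSr.
  do ?[apply: ubM | apply: ubD | apply: ubN | apply: ub_pow | exact: ub_nat
    | exact: ub0 | exact: ubd] => //.
Qed.

Theorem ub_check_chr l i j : ub (Cc l i j).
Proof. exact: modu_ub (ub_lim l i j) (modu_check_chr l i j). Qed.
End Soliton.

(** * Calculus of the difference quotients *)

(* A one-sided substitute for openness, satisfied by U x (0, T] at t = T too. *)
Definition lower_box (R : realType) (m : nat) (D : set 'rV[R]_m) : Prop :=
  forall x, D x -> exists2 e : R, 0 < e &
    forall y : 'rV[R]_m, (forall i, x 0 i - e < y 0 i <= x 0 i) -> D y.

Section Pderiv.
Variables (R : realType) (m : nat).
Implicit Types (D : set 'rV[R]_m) (f g : 'rV[R]_m -> R) (x y : 'rV[R]_m).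

Lemma rv_nbhsP x (P : set 'rV[R]_m) :
  nbhs x P <->
  exists2 e : R, 0 < e & forall y, (forall i, `|x 0 i - y 0 i| < e) -> P y.
Proof.
split=> [/nbhs_ballP[e /= e0 xP]|[e e0 xP]].
  exists e => // y xy; apply: xP; split => // i j.
  by rewrite (ord1 i); exact: xy.
apply/nbhs_ballP; exists e => // y [_ xy]; apply: xP => i; exact: xy.
Qed.

Definition dirs D (i : 'I_m) x : set_system R :=
  within [set h : R | D (x + h *: delta_mx 0 i)] (0 : R)^'.

Lemma shiftE x (h : R) (i j : 'I_m) :
  (x + h *: delta_mx 0 i) 0 j = x 0 j + h * (j == i)%:R.
Proof. by rewrite !mxE eqxx. Qed.

Lemma dirs_filter D i x : Filter (dirs D i x).
Proof. exact: within_filter. Qed.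

(** A lower box contains all small steps in a negative coordinate direction. Hence the filter of
    admissible steps is proper, and derivatives are unique limits, also at t = T. *)
Lemma dirs_proper D i x : lower_box D -> D x -> ProperFilter (dirs D i x).
Proof.
move=> bD Dx; apply: Build_ProperFilter_ex => P.
rewrite /dirs /within /= => /nbhs_ballP[e /= e0 eP].
have [e' e'0 De'] := bD x Dx.
pose h := - (Num.min e e' / 2).
have h0 : 0 < Num.min e e' / 2 by rewrite divr_gt0 // lt_min e0.
have he : Num.min e e' / 2 < e.
  by rewrite ltr_pdivrMr // gt_min ltr_pMr // ltr1n.
have he' : Num.min e e' / 2 < e'.
  by rewrite ltr_pdivrMr // gt_min (ltr_pMr _ e'0) // ltr1n orbT.
exists h; apply: eP.
- by rewrite /ball /= sub0r opprK gtr0_norm.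
- by rewrite /h oppr_eq0 gt_eqF.
- apply: De' => j; rewrite shiftE; case: eqP => _; rewrite ?mulr1 ?mulr0 /h.
    by apply/andP; split; lra.
  by apply/andP; split; lra.
Qed.

Lemma shift_cvg D i x :
  (fun h : R => x + h *: delta_mx 0 i) @ dirs D i x --> within D (nbhs x).
Proof.
move=> P; rewrite /within /= => /rv_nbhsP[e e0 eP].
rewrite /dirs; apply/nbhs_ballP; exists e => //= h.
rewrite /ball /= sub0r normrN => he h0 Dh; apply: eP => // j.
rewrite shiftE opprD addrA subrr sub0r normrN normrM.
by case: eqP => _; rewrite ?normr1 ?normr0 ?mulr1 ?mulr0.
Qed.

Lemma shift_continuous D i x f : {within D, continuous f} -> D x ->
  f (x + h *: delta_mx 0 i) @[h --> dirs D i x] --> f x.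
Proof.
move=> /subspace_continuousP cf Dx.
apply: cvg_trans (cf x Dx) => P; exact: shift_cvg.
Qed.

Lemma pderiv_unique D i x f (l : R) : lower_box D -> D x ->
  diffquot D i f x --> l -> pderiv D i f x = l.
Proof.
move=> bD Dx fl; have FF := dirs_proper i bD Dx.
by apply: cvg_lim => //; exact: norm_hausdorff.
Qed.

(** Serves to change the domain, as between U x [0, T] and U x (0, T] near a point with t > 0. *)
Lemma eq_diffquot D D' i x f g :
  (\forall y \near x, D y <-> D' y) -> D x -> (forall y, D y -> f y = g y) ->
  diffquot D i f x = diffquot D' i g x.
Proof.
move=> /rv_nbhsP[e e0 DD'] Dx fg.
have DE h : `|0 - h| < e -> D (x + h *: delta_mx 0 i) <-> D' (x + h *: delta_mx 0 i).
  rewrite sub0r normrN => he; apply: DD' => j.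
  rewrite shiftE opprD addrA subrr sub0r normrN normrM.
  by case: eqP => _; rewrite ?normr1 ?normr0 ?mulr1 ?mulr0.
rewrite predeqE => P; rewrite /diffquot /=; split => /nbhs_ballP[e' /= e'0 eP];
  apply/nbhs_ballP; exists (Num.min e e'); rewrite /= ?lt_min ?e0 //= => h;
  rewrite /ball /= lt_min => /andP[he he'] h0 Dh.
- by have Dh' := (DE h he).2 Dh; rewrite -!fg //; exact: eP.
- by have Dh' := (DE h he).1 Dh; rewrite /= !fg //; exact: eP.
Qed.

Lemma eq_pderiv D D' i x f g :
  (\forall y \near x, D y <-> D' y) -> D x -> (forall y, D y -> f y = g y) ->
  pderiv D i f x = pderiv D' i g x.
Proof. by move=> DD' Dx fg; rewrite /pderiv (eq_diffquot i DD' Dx fg). Qed.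

Lemma diffquot_cst D i x (c : R) : diffquot D i (fun=> c) x --> (0 : R).
Proof.
have FF : Filter (within [set h : R | D (x + h *: delta_mx 0 i)] (0 : R)^')
  := dirs_filter D i x.
rewrite /diffquot; under eq_fun do rewrite subrr mulr0.
exact: cvg_cst.
Qed.

Lemma diffquot_add D i x f g (l k : R) :
  diffquot D i f x --> l -> diffquot D i g x --> k ->
  diffquot D i (fun y => f y + g y) x --> l + k.
Proof.
have FF : Filter (within [set h : R | D (x + h *: delta_mx 0 i)] (0 : R)^')
  := dirs_filter D i x.
rewrite /diffquot => fl gk; have H := cvgD (FF := FF) fl gk.
refine (cvg_trans _ H).
by under eq_fun do rewrite opprD addrACA mulrDr.
Qed.

Lemma diffquot_mul D i x f g (l k : R) :
  {within D, continuous f} -> D x ->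
  diffquot D i f x --> l -> diffquot D i g x --> k ->
  diffquot D i (fun y => f y * g y) x --> l * g x + f x * k.
Proof.
have FF : Filter (within [set h : R | D (x + h *: delta_mx 0 i)] (0 : R)^')
  := dirs_filter D i x.
rewrite /diffquot => cf Dx fl gk; have := @shift_continuous D i x f cf Dx.
rewrite /dirs => cs; have := cvgD (FF := FF)
  (cvgM (FF := FF) fl (cvg_cst (g x) (FF := FF))) (cvgM (FF := FF) cs gk).
move=> H; refine (cvg_trans _ H).
rewrite (_ : (fun h : R => h^-1 * _) = (fun h => h^-1 *
   (f (x + h *: delta_mx 0 i) - f x) * g x + f (x + h *: delta_mx 0 i) *
   (h^-1 * (g (x + h *: delta_mx 0 i) - g x)))) //.
by apply/funext => h; ring.
Qed.

Lemma diffquot_inv D i x f (l : R) :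
  {within D, continuous f} -> D x -> (forall y, D y -> f y != 0) ->
  diffquot D i f x --> l ->
  diffquot D i (fun y => (f y)^-1) x --> - ((f x)^-1 * (f x)^-1 * l).
Proof.
have FF : Filter (within [set h : R | D (x + h *: delta_mx 0 i)] (0 : R)^')
  := dirs_filter D i x.
rewrite /diffquot => cf Dx f0 fl; have := @shift_continuous D i x f cf Dx.
rewrite /dirs => cs.
have fxV := cvgV (FF := FF) (f0 _ Dx) cs.
have := cvgN (FF := FF) (cvgM (FF := FF) (cvgM (FF := FF) fxV
  (cvg_cst (f x)^-1 (FF := FF))) fl).
move=> H; refine (cvg_trans _ H); apply: near_eq_cvg; rewrite /within /=.
have h : dirs D i x [set h : R | D (x + h *: delta_mx 0 i)].
  by apply/nbhs_ballP; exists 1 => //= h _ h0.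
apply: filterS h => h /= Dh.
have E (a b c : R) : a != 0 -> b != 0 ->
    - (a^-1 * b^-1 * (c * (a - b))) = c * (a^-1 - b^-1).
  by move=> a0 b0; field; rewrite a0 b0.
by apply: E; exact: f0.
Qed.

Lemma diffquot_coord D i j x :
  diffquot D i (fun y : 'rV[R]_m => y 0 j) x --> ((i == j)%:R : R).
Proof.
have FF : Filter (within [set h : R | D (x + h *: delta_mx 0 i)] (0 : R)^')
  := dirs_filter D i x.
rewrite /diffquot; have H := cvg_cst ((i == j)%:R : R) (FF := FF).
refine (cvg_trans _ H); apply: near_eq_cvg.
have h : dirs D i x [set h : R | h != 0].
  by apply/nbhs_ballP; exists 1 => //= h _ h0.
apply: filterS h => h /= h0.
by rewrite shiftE addrAC subrr add0r mulrA mulVf // mul1r eq_sym.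
Qed.

Lemma coord_continuous_within D j :
  {within D, continuous (fun y : 'rV[R]_m => y 0 j)}.
Proof. by apply: continuous_subspaceT; exact: coord_continuous. Qed.

Lemma continuous_withinP D f : {within D, continuous f} <->
  forall x, D x -> forall e : R, 0 < e -> exists2 r : R, 0 < r &
    forall y, D y -> (forall i, `|x 0 i - y 0 i| < r) -> `|f x - f y| < e.
Proof.
split=> [/subspace_continuousP cf x Dx e e0|H].
  have /cvgrPdist_lt/(_ e e0) := cf x Dx.
  rewrite /within /= => /rv_nbhsP[r r0 rP]; exists r => // y Dy xy.
  exact: rP.
apply/subspace_continuousP => x Dx; apply/cvgrPdist_lt => e e0.
have [r r0 rP] := H x Dx e e0; apply/rv_nbhsP; exists r => // y xy Dy.
exact: rP.
Qed.
End Pderiv.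

Section CkCalculus.
Variables (R : realType) (m : nat) (D : set 'rV[R]_m).
Hypothesis bD : lower_box D.
Implicit Types (f g : 'rV[R]_m -> R) (x y : 'rV[R]_m).

Lemma Ck_continuous k f : Ck D k f -> {within D, continuous f}.
Proof. by case: k => [|k] []. Qed.

Lemma Ck_diffquot k i x f : Ck D k.+1 f -> D x ->
  diffquot D i f x --> pderiv D i f x.
Proof. by move=> [_ /(_ i)[df _]] Dx; exact: df. Qed.

Lemma Ck_pderiv k i f : Ck D k.+1 f -> Ck D k (pderiv D i f).
Proof. by case=> _ /(_ i)[]. Qed.

Lemma eq_continuous_within f g : (forall y, D y -> f y = g y) ->
  {within D, continuous f} -> {within D, continuous g}.
Proof.
move=> fg /continuous_withinP cf; apply/continuous_withinP => x Dx e e0.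
have [r r0 rP] := cf x Dx e e0; exists r => // y Dy xy.
by rewrite -!fg //; exact: rP.
Qed.

Lemma eq_Ck k f g : (forall y, D y -> f y = g y) -> Ck D k f -> Ck D k g.
Proof.
elim: k f g => [|k IH] f g fg [cf].
  by split=> //; exact: eq_continuous_within cf.
move=> df; split; first exact: eq_continuous_within cf.
have nD x : \forall y \near x, D y <-> D y by apply: filterE.
move=> i; have [dfi Cfi] := df i; split=> [x Dx|].
  by rewrite -(eq_diffquot i (nD x) Dx fg); exact: dfi.
by apply: IH Cfi => y Dy; exact: (eq_pderiv i (nD y) Dy fg).
Qed.

(** [Ck] recurs on [pderiv], a limit chosen at every point. This replaces it by any formula that
    gives the derivative on [D]. *)
Lemma Ck_step k f (f' : 'I_m -> 'rV[R]_m -> R) :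
  {within D, continuous f} ->
  (forall i x, D x -> diffquot D i f x --> f' i x) ->
  (forall i, Ck D k (f' i)) -> Ck D k.+1 f.
Proof.
move=> cf df Cf; split=> // i; split=> [x Dx|].
  by apply/cvg_ex; exists (f' i x); exact: df.
apply: eq_Ck (Cf i) => y Dy; apply/esym.
by apply: pderiv_unique => //; exact: df.
Qed.

Lemma Ck_leS k f : Ck D k.+1 f -> Ck D k f.
Proof.
elim: k f => [|k IH] f [cf df]; split=> // i.
by have [? ?] := df i; split=> //; exact: IH.
Qed.

Lemma Ck_cst k (c : R) : Ck D k (fun=> c).
Proof.
have cc (a : R) : {within D, continuous (fun=> a)}.
  by apply: continuous_subspaceT; exact: cst_continuous.
elim: k c => [|k IH] c; first by split.
by apply: (@Ck_step _ _ (fun _ _ => 0)) => // i x _; exact: diffquot_cst.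
Qed.

Lemma Ck_coord k j : Ck D k (fun y : 'rV[R]_m => y 0 j).
Proof.
case: k => [|k]; first by split => //; exact: coord_continuous_within.
apply: (@Ck_step _ _ (fun i _ => (i == j)%:R)) => [|i x _|i].
- exact: coord_continuous_within.
- exact: diffquot_coord.
- exact: Ck_cst.
Qed.

Lemma continuous_within_add f g : {within D, continuous f} ->
  {within D, continuous g} -> {within D, continuous (fun y => f y + g y)}.
Proof. by move=> cf cg x; apply: cvgD; [exact: cf | exact: cg]. Qed.

Lemma continuous_within_mul f g : {within D, continuous f} ->
  {within D, continuous g} -> {within D, continuous (fun y => f y * g y)}.
Proof. by move=> cf cg x; apply: cvgM; [exact: cf | exact: cg]. Qed.

Lemma Ck_add k f g : Ck D k f -> Ck D k g -> Ck D k (fun y => f y + g y).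
Proof.
elim: k f g => [|k IH] f g Cf Cg.
  by split=> //; apply: continuous_within_add;
    [exact: Ck_continuous Cf | exact: Ck_continuous Cg].
apply: (@Ck_step _ _ (fun i y => pderiv D i f y + pderiv D i g y)).
- by apply: continuous_within_add;
    [exact: Ck_continuous Cf | exact: Ck_continuous Cg].
- by move=> i x Dx; apply: diffquot_add;
    [exact: Ck_diffquot Cf Dx | exact: Ck_diffquot Cg Dx].
- by move=> i; apply: IH; exact: Ck_pderiv.
Qed.

Lemma Ck_mul k f g : Ck D k f -> Ck D k g -> Ck D k (fun y => f y * g y).
Proof.
elim: k f g => [|k IH] f g Cf Cg.
  by split=> //; apply: continuous_within_mul;
    [exact: Ck_continuous Cf | exact: Ck_continuous Cg].
apply: (@Ck_step _ _ (fun i y => pderiv D i f y * g y + f y * pderiv D i g y)).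
- by apply: continuous_within_mul;
    [exact: Ck_continuous Cf | exact: Ck_continuous Cg].
- move=> i x Dx; apply: diffquot_mul => //.
  + exact: Ck_continuous Cf.
  + exact: Ck_diffquot Cf Dx.
  + exact: Ck_diffquot Cg Dx.
- by move=> i; apply: Ck_add; apply: IH; try exact: Ck_pderiv; exact: Ck_leS.
Qed.

Lemma continuous_within_inv f : (forall y, D y -> f y != 0) ->
  {within D, continuous f} -> {within D, continuous (fun y => (f y)^-1)}.
Proof.
move=> f0 /subspace_continuousP cf; apply/subspace_continuousP => x Dx.
by apply: cvgV; [exact: f0 | exact: cf].
Qed.

Lemma Ck_inv k f : (forall y, D y -> f y != 0) ->
  Ck D k f -> Ck D k (fun y => (f y)^-1).
Proof.
move=> f0; elim: k => [|k IH] Cf.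
  by split=> //; apply: continuous_within_inv => //; exact: Ck_continuous Cf.
apply: (@Ck_step _ _ (fun i y => -1 * ((f y)^-1 * (f y)^-1 * pderiv D i f y))).
- by apply: continuous_within_inv => //; exact: Ck_continuous Cf.
- move=> i x Dx; rewrite mulN1r; apply: diffquot_inv => //.
    exact: Ck_continuous Cf.
  exact: Ck_diffquot Cf Dx.
- have If := IH (Ck_leS Cf).
  move=> i; apply: Ck_mul; first exact: Ck_cst.
  by apply: Ck_mul; [exact: Ck_mul | exact: Ck_pderiv].
Qed.

Section Line.
Variables (f : 'rV[R]_m -> R) (i : 'I_m) (y : 'rV[R]_m) (h : R).
Hypothesis Cf : Ck D 1 f.
Hypothesis seg : forall s : R, - h <= s <= 0 -> D (y + s *: delta_mx 0 i).

(** Strictly inside the segment both directions stay in [D], so the quotient within [D] is the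
    ordinary one. This makes the mean value theorem available up to the endpoint [y], which may lie
    on the boundary. *)
Lemma line_is_derive (s : R) : - h < s < 0 ->
  is_derive s (1 : R) (fun s => f (y + s *: delta_mx 0 i))
    (pderiv D i f (y + s *: delta_mx 0 i)).
Proof.
move=> /andP[hs s0]; set z := y + s *: _.
have Dz : D z by apply: seg; rewrite !ltW.
have H : (fun k : R => k^-1 *: (f (y + (k *: 1 + s) *: delta_mx 0 i) - f z))
    @ (0 : R)^' --> pderiv D i f z.
  move=> P /(Ck_diffquot (i := i) Cf Dz).
  rewrite /diffquot /within /= => /nbhs_ballP[e /= e0 eP].
  apply/nbhs_ballP; exists (Num.min e (Num.min (- s) (s + h))) => /=.
    by rewrite !lt_min e0 /=; apply/andP; split; lra.
  move=> k; rewrite /ball /= !lt_min sub0r normrN => /andP[ke /andP[k1 k2]] k0.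
  have -> : y + (k *: 1 + s) *: delta_mx 0 i = z + k *: delta_mx 0 i.
    by rewrite /z -addrA -scalerDl [k *: 1]mulr1 [k + s]addrC.
  apply: eP => //; first by rewrite /ball /= sub0r normrN.
  rewrite /z -addrA -scalerDl; apply: seg.
  move: k1 k2; rewrite !ltr_norml => /andP[? ?] /andP[? ?].
  by apply/andP; split; lra.
split; first by apply/cvg_ex; exists (pderiv D i f z).
by apply: cvg_lim H; exact: norm_hausdorff.
Qed.

Lemma line_continuous :
  {within `[- h, 0], continuous (fun s => f (y + s *: delta_mx 0 i))}.
Proof.
have /continuous_withinP cf := Ck_continuous Cf.
apply/subspace_continuousP => s /=; rewrite in_itv /= => hs.
apply/cvgrPdist_lt => e e0; have [r r0 rP] := cf _ (seg hs) e e0.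
rewrite /within /=; apply/nbhs_ballP; exists r => //= s'.
rewrite /ball /= in_itv /= => ss' hs'; apply: rP; first exact: seg.
move=> j; rewrite !mxE eqxx /= opprD addrACA subrr add0r -mulrBl normrM.
by case: eqP => _; rewrite ?normr1 ?normr0 ?mulr1 ?mulr0.
Qed.

Lemma line_mvt : 0 < h -> exists2 c : R, - h < c < 0 &
  f y - f (y - h *: delta_mx 0 i) = pderiv D i f (y + c *: delta_mx 0 i) * h.
Proof.
move=> h0; have hN : - h < 0 by rewrite oppr_lt0.
have der (s : R) : s \in `]- h, 0[%R -> is_derive s (1 : R)
    (fun s => f (y + s *: delta_mx 0 i)) (pderiv D i f (y + s *: delta_mx 0 i)).
  by rewrite in_itv /=; exact: line_is_derive.
have [c] := MVT hN der line_continuous; rewrite in_itv /= => hc.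
rewrite scale0r addr0 scaleNr sub0r opprK.
by exists c.
Qed.
End Line.

(* The second difference of f over a small square with corner x is a value of
   either mixed derivative near x, times the area. *)
Lemma pderivC f x i j : Ck D 2 f -> D x ->
  pderiv D i (pderiv D j f) x = pderiv D j (pderiv D i f) x.
Proof.
move=> Cf Dx; have [->//|ij] := eqVneq i j.
have [e e0 De] := bD Dx.
pose pt (s r : R) := x + s *: delta_mx 0 i + r *: delta_mx 0 j.
have ptE s r k : pt s r 0 k = x 0 k + s * (k == i)%:R + r * (k == j)%:R.
  by rewrite /pt !mxE eqxx.
have ptC s r : pt s r = x + r *: delta_mx 0 j + s *: delta_mx 0 i.
  by rewrite /pt addrAC.
have Dpt (h s r : R) : h < e -> - h <= s <= 0 -> - h <= r <= 0 -> D (pt s r).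
  move=> he /andP[s1 s2] /andP[r1 r2]; apply: De => k; rewrite ptE.
  have [->|_] := eqVneq k i; first by
    rewrite (negPf ij) mulr1 mulr0; apply/andP; split; lra.
  by case: eqP => _; rewrite ?mulr1 !mulr0; apply/andP; split; lra.
(* Stated for any parametrization [q] of the square, so that it applies again with the two
   directions exchanged. *)
have main i' j' (q : R -> R -> 'rV[R]_m) (h : R) : 0 < h ->
    (forall s r, - h <= s <= 0 -> - h <= r <= 0 -> D (q s r)) ->
    (forall s r, q s r = q 0 r + s *: delta_mx 0 i') ->
    (forall s r, q s r = q s 0 + r *: delta_mx 0 j') ->
  exists s r, [/\ - h <= s <= 0, - h <= r <= 0 &
    f (q 0 0) - f (q 0 (- h)) - (f (q (- h) 0) - f (q (- h) (- h)))
    = pderiv D j' (pderiv D i' f) (q s r) * h * h].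
  move=> h0 Dq qi qj; have hN : - h < 0 by rewrite oppr_lt0.
  have h1 : - h <= - h <= 0 by apply/andP; split; lra.
  have h2 : - h <= (0 : R) <= 0 by apply/andP; split; lra.
  have Df r : - h <= r <= 0 -> forall s, - h <= s <= 0 ->
      D (q 0 r + s *: delta_mx 0 i').
    by move=> hr s hs; rewrite -qi; exact: Dq.
  pose df (s : R) := pderiv D i' f (q 0 0 + s *: delta_mx 0 i')
    - pderiv D i' f (q 0 (- h) + s *: delta_mx 0 i').
  have C1 := Ck_leS Cf.
  pose F (s : R) := f (q 0 0 + s *: delta_mx 0 i')
    - f (q 0 (- h) + s *: delta_mx 0 i').
  have derF (s : R) : s \in `]- h, 0[%R -> is_derive s (1 : R) F (df s).
    rewrite in_itv /= => hs; apply: is_deriveB;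
      by apply: (@line_is_derive _ _ _ h) => //; exact: Df.
  have contF : {within `[- h, 0], continuous F}.
    by move=> s; apply: cvgB; apply: line_continuous => //; exact: Df.
  have [c] := MVT hN derF contF; rewrite in_itv /= => /andP[c1 c2].
  rewrite /F /df -!qi sub0r opprK => ->.
  have hc : - h <= c <= 0 by rewrite !ltW.
  have seg r : - h <= r <= 0 -> D (q c 0 + r *: delta_mx 0 j').
    by move=> hr; rewrite -qj; exact: Dq.
  have [r /andP[r1 r2]] := line_mvt (Ck_pderiv i' Cf) seg h0.
  rewrite -scaleNr -!qj => ->; exists c, r; split=> //.
  by rewrite !ltW.
have FC : Ck D 0 (pderiv D i (pderiv D j f)) by do 2!apply: Ck_pderiv.
have FC' : Ck D 0 (pderiv D j (pderiv D i f)) by do 2!apply: Ck_pderiv.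
apply/eqP; rewrite -subr_eq0 -normr_le0 leNgt; apply/negP => d0.
set d := `|_| in d0.
have d2 : 0 < d / 2 by rewrite divr_gt0.
have px : pt 0 0 = x by rewrite /pt !scale0r !addr0.
have /continuous_withinP/(_ x Dx _ d2)[a a0 aP] := Ck_continuous FC.
have /continuous_withinP/(_ x Dx _ d2)[b b0 bP] := Ck_continuous FC'.
(* The square is so small that it lies in [D] and each mixed derivative stays within d/2 of its
   value at x. The two share a value on the square, which forces d < d. *)
pose h := Num.min e (Num.min a b) / 2.
have h0 : 0 < h by rewrite divr_gt0 // !lt_min e0 a0.
have [he ha hb] : [/\ h < e, h < a & h < b].
  have hm : h < Num.min e (Num.min a b).
    by rewrite /h ltr_pdivrMr // ltr_pMr ?ltr1n // !lt_min e0 a0.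
  by move: hm; rewrite !lt_min => /andP[? /andP[]].
clearbody h.
have near s r k : - h <= s <= 0 -> - h <= r <= 0 ->
    `|x 0 k - pt s r 0 k| <= h.
  move=> /andP[s1 s2] /andP[r1 r2]; rewrite ptE -addrA opprD addrA subrr sub0r.
  rewrite normrN ler_norml; have [->|_] := eqVneq k i.
    by rewrite (negPf ij) mulr1 mulr0; apply/andP; split; lra.
  by case: eqP => _; rewrite ?mulr1 !mulr0; apply/andP; split; lra.
have Dpt' s r := @Dpt h s r he.
have qi s r : pt s r = pt 0 r + s *: delta_mx 0 i.
  by rewrite /pt scale0r addr0 addrAC.
have qj s r : pt s r = pt s 0 + r *: delta_mx 0 j.
  by rewrite /pt scale0r addr0.
have [s [r [hs hr E1]]] := main i j pt h h0 Dpt' qi qj.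
have [r' [s' [hr' hs' E2]]] := main j i (fun r s => pt s r) h h0
  (fun r s hr hs => Dpt' s r hs hr) (fun r s => qj s r) (fun r s => qi s r).
have h20 : h * h != 0 by rewrite mulf_neq0 // gt_eqF.
have E : pderiv D j (pderiv D i f) (pt s r) = pderiv D i (pderiv D j f) (pt s' r').
  have sw (k l p q : R) : k - l - (p - q) = k - p - (l - q) by ring.
  apply: (mulIf h20); rewrite /= !mulrA.
  exact: etrans (esym E1) (etrans (sw _ _ _ _) E2).
have A1 := aP _ (Dpt' _ _ hs' hr') (fun k => le_lt_trans (near s' r' k hs' hr') ha).
have A2 := bP _ (Dpt' _ _ hs hr) (fun k => le_lt_trans (near s r k hs hr) hb).
have: d < d / 2 + d / 2; last by rewrite -splitr ltxx.
rewrite {1}/d; set u := pderiv D i _ x; set v := pderiv D j _ x.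
set w := pderiv D i (pderiv D j f) (pt s' r') in E A1.
have sb (k l p : R) : k - l = (k - p) - (l - p) by ring.
rewrite (sb u v w).
apply: le_lt_trans (ler_normB _ _) _.
rewrite E in A2; exact: ltrD A1 A2.
Qed.
End CkCalculus.

(** The domains must agree near each point of [D'], not merely be nested, because every derivative
    is a limit within its domain. *)
Lemma Ck_restrict (R : realType) (m : nat) (D D' : set 'rV[R]_m) k f :
  (forall x, D' x -> D x /\ \forall y \near x, D' y <-> D y) ->
  Ck D k f -> Ck D' k f.
Proof.
move=> DD'; elim: k f => [|k IH] f [cf df].
  by split=> //; apply: continuous_subspaceW cf => x /DD'[].
split; first by apply: continuous_subspaceW cf => x /DD'[].
move=> i; have [dfi Cfi] := df i; split=> [x D'x|].
  have [Dx nx] := DD' x D'x.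
  by rewrite (eq_diffquot i nx D'x (fun _ _ => erefl)); exact: dfi.
apply: eq_Ck (IH _ Cfi) => y D'y; have [Dy ny] := DD' y D'y.
by rewrite (eq_pderiv i ny D'y (fun _ _ => erefl)).
Qed.

Section SmoothOn.
Variables (R : realType) (m : nat) (D : set 'rV[R]_m).
Hypothesis bD : lower_box D.
Implicit Types f g : 'rV[R]_m -> R.

Lemma eq_smooth f g :
  (forall y, D y -> f y = g y) -> smooth_on D f -> smooth_on D g.
Proof. by move=> fg Sf k; exact: eq_Ck (Sf k). Qed.

Lemma smooth_cst (c : R) : smooth_on D (fun=> c).
Proof. by move=> k; exact: Ck_cst. Qed.

Lemma smooth_coord j : smooth_on D (fun y : 'rV[R]_m => y 0 j).
Proof. by move=> k; exact: Ck_coord. Qed.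

Lemma smooth_add f g :
  smooth_on D f -> smooth_on D g -> smooth_on D (fun y => f y + g y).
Proof. by move=> Sf Sg k; exact: Ck_add. Qed.

Lemma smooth_mul f g :
  smooth_on D f -> smooth_on D g -> smooth_on D (fun y => f y * g y).
Proof. by move=> Sf Sg k; exact: Ck_mul. Qed.

Lemma smooth_opp f : smooth_on D f -> smooth_on D (fun y => - f y).
Proof.
move=> Sf; apply: (@eq_smooth (fun y => -1 * f y)).
  by move=> y _; rewrite mulN1r.
by apply: smooth_mul => //; exact: smooth_cst.
Qed.

Lemma smooth_inv f : (forall y, D y -> f y != 0) ->
  smooth_on D f -> smooth_on D (fun y => (f y)^-1).
Proof. by move=> f0 Sf k; exact: Ck_inv. Qed.

Lemma smooth_pderiv i f : smooth_on D f -> smooth_on D (pderiv D i f).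
Proof. by move=> Sf k; apply: Ck_pderiv; exact: Sf. Qed.

Lemma smooth_sum (I : Type) (r : seq I) (F : I -> 'rV[R]_m -> R) :
  (forall i, smooth_on D (F i)) -> smooth_on D (fun y => \sum_(i <- r) F i y).
Proof.
move=> SF; elim: r => [|i r IH].
  by apply: (@eq_smooth (fun=> 0)) => [y _|]; [rewrite big_nil | exact: smooth_cst].
apply: (@eq_smooth (fun y => F i y + \sum_(j <- r) F j y)) => [y _|].
  by rewrite big_cons.
exact: smooth_add.
Qed.

Lemma smooth_prod (I : Type) (r : seq I) (F : I -> 'rV[R]_m -> R) :
  (forall i, smooth_on D (F i)) -> smooth_on D (fun y => \prod_(i <- r) F i y).
Proof.
move=> SF; elim: r => [|i r IH].
  by apply: (@eq_smooth (fun=> 1)) => [y _|]; [rewrite big_nil | exact: smooth_cst].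
apply: (@eq_smooth (fun y => F i y * \prod_(j <- r) F j y)) => [y _|].
  by rewrite big_cons.
exact: smooth_mul.
Qed.

Lemma smooth_det k (A : 'rV[R]_m -> 'M[R]_k) :
  (forall a b, smooth_on D (fun y => A y a b)) ->
  smooth_on D (fun y => \det (A y)).
Proof.
move=> SA; apply: smooth_sum => s; apply: smooth_mul; first exact: smooth_cst.
by apply: smooth_prod.
Qed.

Lemma smooth_invmx k (A : 'rV[R]_m -> 'M[R]_k) a b :
  (forall y, D y -> A y \in unitmx) ->
  (forall a b, smooth_on D (fun y => A y a b)) ->
  smooth_on D (fun y => invmx (A y) a b).
Proof.
move=> uA SA.
apply: (@eq_smooth (fun y => (\det (A y))^-1 *
    ((-1) ^+ (b + a) * \det (row' b (col' a (A y)))))).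
  by move=> y Dy; rewrite /invmx uA // !mxE.
apply: smooth_mul; first apply: smooth_inv.
- by move=> y /uA; rewrite unitmxE unitfE.
- exact: smooth_det.
- apply: smooth_mul; first exact: smooth_cst.
  apply: smooth_det => i j; apply: eq_smooth (SA (lift b i) (lift a j)) => y _.
  by rewrite !mxE.
Qed.
End SmoothOn.

(** * The ring of families of smooth functions *)

Record boxdom (R : realType) (m : nat) := BoxDom {
  bdom :> set 'rV[R]_m ;
  bdomP : lower_box bdom }.
Arguments bdomP {R m} b : rename.

(* Vanishing outside D turns equality on D into Leibniz equality. *)
Record smooth_family (J : Type) (R : realType) (m : nat) (D : boxdom R m) :=
  SmoothFamily {
  sf_val :> J -> 'rV[R]_m -> R ;
  sf_smooth : forall j, smooth_on D (sf_val j) ;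
  sf_out : forall j x, ~ bdom D x -> sf_val j x = 0 }.

Section SmoothFamilyRing.
Variables (J : Type) (R : realType) (m : nat) (D : boxdom R m).
Local Notation fam := (smooth_family J D).
Implicit Types a b c : fam.

Lemma sf_eq a b : (forall j x, bdom D x -> a j x = b j x) -> a = b.
Proof.
case: a b => [a sa oa] [b sb ob] /= ab.
have e : a = b.
  apply/funext => j; apply/funext => x.
  by have [/ab//|Dx] := pselect (bdom D x); rewrite oa ?ob.
by case: _ / e in sb ob *; congr SmoothFamily; exact: Prop_irrelevance.
Qed.

Section Mk.
Variable f : J -> 'rV[R]_m -> R.
Hypothesis Sf : forall j, smooth_on D (f j).

Let mk_val j x := if `[< bdom D x >] then f j x else 0.

Let mk_smooth j : smooth_on D (mk_val j).
Proof. by apply: eq_smooth (Sf j) => x Dx; rewrite /mk_val asboolT. Qed.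

Let mk_out j x : ~ bdom D x -> mk_val j x = 0.
Proof. by move=> Dx; rewrite /mk_val asboolF. Qed.

Definition sf_mk : fam := SmoothFamily mk_smooth mk_out.

Lemma sf_mkE j x : bdom D x -> sf_mk j x = f j x.
Proof. by move=> Dx; rewrite /= /mk_val asboolT. Qed.
End Mk.

HB.instance Definition _ := gen_eqMixin fam.
HB.instance Definition _ := gen_choiceMixin fam.

Definition sf_cst (c : J -> R) : fam := sf_mk (fun j => smooth_cst (bdomP D) (c j)).
Definition sf_add a b : fam :=
  sf_mk (fun j => smooth_add (bdomP D) (sf_smooth a j) (sf_smooth b j)).
Definition sf_mul a b : fam :=
  sf_mk (fun j => smooth_mul (bdomP D) (sf_smooth a j) (sf_smooth b j)).
Definition sf_opp a : fam := sf_mk (fun j => smooth_opp (bdomP D) (sf_smooth a j)).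
Definition sf_der (i : 'I_m) a : fam :=
  sf_mk (fun j => smooth_pderiv i (sf_smooth a j)).

Let sf_addA : associative sf_add.
Proof. by move=> a b c; apply: sf_eq => j x Dx; rewrite !sf_mkE // addrA. Qed.
Let sf_addC : commutative sf_add.
Proof. by move=> a b; apply: sf_eq => j x Dx; rewrite !sf_mkE // addrC. Qed.
Let sf_add0 : left_id (sf_cst (fun=> 0)) sf_add.
Proof. by move=> a; apply: sf_eq => j x Dx; rewrite !sf_mkE // add0r. Qed.
Let sf_addN : left_inverse (sf_cst (fun=> 0)) sf_opp sf_add.
Proof. by move=> a; apply: sf_eq => j x Dx; rewrite !sf_mkE // addNr. Qed.

HB.instance Definition _ :=
  GRing.isZmodule.Build fam sf_addA sf_addC sf_add0 sf_addN.

Let sf_mulA : associative sf_mul.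
Proof. by move=> a b c; apply: sf_eq => j x Dx; rewrite !sf_mkE // mulrA. Qed.
Let sf_mulC : commutative sf_mul.
Proof. by move=> a b; apply: sf_eq => j x Dx; rewrite !sf_mkE // mulrC. Qed.
Let sf_mul1 : left_id (sf_cst (fun=> 1)) sf_mul.
Proof. by move=> a; apply: sf_eq => j x Dx; rewrite !sf_mkE // mul1r. Qed.
Let sf_mulDl : left_distributive sf_mul +%R.
Proof. by move=> a b c; apply: sf_eq => j x Dx; rewrite !sf_mkE // mulrDl. Qed.

HB.instance Definition _ :=
  GRing.Zmodule_isComPzRing.Build fam sf_mulA sf_mulC sf_mul1 sf_mulDl.

Section Eval.
Variables (j : J) (x : 'rV[R]_m).
Hypothesis Dx : bdom D x.

Lemma sf_addE a b : (a + b) j x = a j x + b j x. Proof. exact: sf_mkE. Qed.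
Lemma sf_mulE a b : (a * b) j x = a j x * b j x. Proof. exact: sf_mkE. Qed.
Lemma sf_oppE a : (- a) j x = - a j x. Proof. exact: sf_mkE. Qed.
Lemma sf_0E : (0 : fam) j x = 0. Proof. exact: sf_mkE. Qed.
Lemma sf_1E : (1 : fam) j x = 1. Proof. exact: sf_mkE. Qed.
Lemma sf_cstE (v : J -> R) : sf_cst v j x = v j. Proof. exact: sf_mkE. Qed.
Lemma sf_derE i a : sf_der i a j x = pderiv D i (a j) x.
Proof. exact: sf_mkE. Qed.
Lemma sf_natE k : (k%:R : fam) j x = k%:R.
Proof. by elim: k => [|k IH]; rewrite ?sf_0E // -!natr1 sf_addE IH sf_1E. Qed.
Lemma sf_sumE (I : Type) (r : seq I) (F : I -> fam) :
  (\sum_(i <- r) F i) j x = \sum_(i <- r) F i j x.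
Proof.
by elim: r => [|i r IH]; rewrite ?big_nil ?sf_0E // !big_cons sf_addE IH.
Qed.
Lemma sf_expE a k : (a ^+ k) j x = a j x ^+ k.
Proof. by elim: k => [|k IH]; rewrite ?sf_1E // !exprS sf_mulE IH. Qed.
End Eval.

Lemma sf_der_val i a (g : J -> 'rV[R]_m -> R) j x :
  bdom D x -> (forall y, bdom D y -> g j y = a j y) ->
  pderiv D i (g j) x = sf_der i a j x.
Proof.
move=> Dx ga; rewrite sf_derE //; apply: eq_pderiv => //.
by apply: filterE.
Qed.

Lemma sf_derP i : derivation (sf_der i).
Proof.
split=> a b; apply: sf_eq => j x Dx; rewrite ?sf_addE // ?sf_mulE //.
  rewrite -(@sf_der_val i _ (fun j y => a j y + b j y)) //; last first.
    by move=> y Dy; rewrite sf_addE.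
  rewrite !sf_derE //; apply: (pderiv_unique (bdomP D)) => //.
  by apply: diffquot_add; [exact: (Ck_diffquot (sf_smooth a j 1))
    | exact: (Ck_diffquot (sf_smooth b j 1))].
rewrite -(@sf_der_val i _ (fun j y => a j y * b j y)) //; last first.
  by move=> y Dy; rewrite sf_mulE.
rewrite !sf_derE //; apply: (pderiv_unique (bdomP D)) => //; apply: diffquot_mul => //.
- exact: Ck_continuous (sf_smooth a j 0).
- exact: (Ck_diffquot (sf_smooth a j 1)).
- exact: (Ck_diffquot (sf_smooth b j 1)).
Qed.

Lemma sf_derC i i' a : sf_der i (sf_der i' a) = sf_der i' (sf_der i a).
Proof.
have E k l j x : bdom D x ->
    sf_der k (sf_der l a) j x = pderiv D k (pderiv D l (a j)) x.
  move=> Dx; apply/esym.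
  apply: (sf_der_val k (g := fun j => pderiv D l (a j))) => // y Dy.
  by rewrite sf_derE.
apply: sf_eq => j x Dx; apply: etrans (E i i' j x Dx) _.
apply: etrans _ (esym (E i' i j x Dx)).
by apply: (pderivC (bdomP D)) => //; exact: sf_smooth.
Qed.

Lemma sf_der_cst i (v : J -> R) : sf_der i (sf_cst v) = 0.
Proof.
apply: sf_eq => j x Dx; rewrite sf_0E //.
rewrite -(@sf_der_val i _ (fun j _ => v j)) //; last first.
  by move=> y Dy; rewrite sf_cstE.
by apply: (pderiv_unique (bdomP D)) => //; exact: diffquot_cst.
Qed.
End SmoothFamilyRing.

Lemma compact_within_bounded (R : realType) (m : nat) (K : set 'rV[R]_m)
    (f : 'rV[R]_m -> R) :
  compact K -> {within K, continuous f} ->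
  exists C : R, forall x, K x -> `|f x| <= C.
Proof.
move=> cK cf; have /compact_bounded[M [_ MP]] := continuous_compact cf cK.
exists (M + 1) => x Kx; apply: MP; first by rewrite ltrDl.
by exists x.
Qed.

(** * Bounds on compact sets, uniform in the index *)

Section UniformlyBounded.
Variables (J : Type) (R : realType) (m : nat) (D : boxdom R m).
Local Notation fam := (smooth_family J D).
Implicit Types a b : fam.

Definition loc_bounded a : Prop := forall K : set 'rV[R]_m,
  compact K -> K `<=` D ->
  exists C : R, forall j x, K x -> `|a j x| <= C.

Fixpoint unif_Ck (k : nat) a : Prop :=
  loc_bounded a /\
  if k is k'.+1 then forall i, unif_Ck k' (sf_der i a) else True.

Definition unif_smooth a : Prop := forall k, unif_Ck k a.

Lemma loc_boundedD a b : loc_bounded a -> loc_bounded b -> loc_bounded (a + b).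
Proof.
move=> la lb K cK KD; have [C CP] := la K cK KD; have [C' CP'] := lb K cK KD.
exists (C + C') => j x Kx; rewrite sf_addE; last exact: KD.
by apply: le_trans (ler_normD _ _) _; apply: lerD; [exact: CP | exact: CP'].
Qed.

Lemma loc_boundedM a b : loc_bounded a -> loc_bounded b -> loc_bounded (a * b).
Proof.
move=> la lb K cK KD; have [C CP] := la K cK KD; have [C' CP'] := lb K cK KD.
exists (C * C') => j x Kx; rewrite sf_mulE; last exact: KD.
by rewrite normrM; apply: ler_pM => //; [exact: CP | exact: CP'].
Qed.

Lemma loc_boundedN a : loc_bounded a -> loc_bounded (- a).
Proof.
move=> la K cK KD; have [C CP] := la K cK KD.
exists C => j x Kx; rewrite sf_oppE; last exact: KD.
by rewrite normrN; exact: CP.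
Qed.

Lemma unif_Ck_leS k a : unif_Ck k.+1 a -> unif_Ck k a.
Proof.
elim: k a => [|k IH] a [la da]; split=> // i.
by apply: IH; exact: da.
Qed.

Lemma unif_CkD k a b : unif_Ck k a -> unif_Ck k b -> unif_Ck k (a + b).
Proof.
elim: k a b => [|k IH] a b [la da] [lb db]; split=> //;
  try exact: loc_boundedD.
by move=> i; rewrite (derD (sf_derP J D i)); apply: IH; [exact: da | exact: db].
Qed.

Lemma unif_CkN k a : unif_Ck k a -> unif_Ck k (- a).
Proof.
elim: k a => [|k IH] a [la da]; split=> //; try exact: loc_boundedN.
by move=> i; rewrite (derN (sf_derP J D i)); apply: IH; exact: da.
Qed.

Lemma unif_CkM k a b : unif_Ck k a -> unif_Ck k b -> unif_Ck k (a * b).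
Proof.
elim: k a b => [|k IH] a b ua ub.
  by split=> //; apply: loc_boundedM; [exact: ua.1 | exact: ub.1].
split=> [|i]; first by apply: loc_boundedM; [exact: ua.1 | exact: ub.1].
rewrite (derM (sf_derP J D i)).
apply: unif_CkD; apply: IH.
- exact: ua.2.
- exact: unif_Ck_leS.
- exact: unif_Ck_leS.
- exact: ub.2.
Qed.

(** Since db = -b^2 da, a bound on the inverse itself propagates to all its derivatives. *)
Lemma unif_smooth_inv a b :
  a * b = 1 -> unif_smooth a -> loc_bounded b -> unif_smooth b.
Proof.
move=> ab ua lb; elim=> [|k IH]; split=> // i.
rewrite (derV (sf_derP J D i) ab); apply: unif_CkN; apply: unif_CkM.
  exact: unif_CkM.
exact: (ua k.+1).2.
Qed.

Lemma loc_bounded_indep a : (forall j j' x, a j x = a j' x) -> loc_bounded a.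
Proof.
move=> ai K cK KD.
(* For an empty index type there is no function to which compactness applies, and any constant is a
   bound. *)
have [[j _]|nJ] := pselect (exists j : J, True); last first.
  by exists 0 => j; case: nJ; exists j.
have [|C CP] := @compact_within_bounded R m K (a j) cK.
  by apply: continuous_subspaceW KD _; exact: Ck_continuous (sf_smooth a j 0).
by exists C => j' x Kx; rewrite (ai j' j); exact: CP.
Qed.

Lemma unif_smooth_indep a : (forall j j' x, a j x = a j' x) -> unif_smooth a.
Proof.
move=> ai k; elim: k a ai => [|k IH] a ai; split=> //;
  try exact: loc_bounded_indep.
move=> i; apply: IH => j j' x.
have e : a j = a j' by apply/funext => y; exact: ai.
by have [Dx|Dx] := pselect (bdom D x);
  [rewrite !sf_derE // e | rewrite !sf_out].
Qed.

Lemma unif_smooth_cst (v : J -> R) (C : R) :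
  (forall j, `|v j| <= C) -> unif_smooth (sf_cst D v).
Proof.
move=> vC k; have lv (w : J -> R) B : (forall j, `|w j| <= B) -> loc_bounded (sf_cst D w).
  by move=> wB K _ KD; exists B => j x /KD Dx; rewrite sf_cstE.
elim: k v C vC => [|k IH] v C vC; split=> //; try exact: lv vC.
by move=> i; rewrite sf_der_cst; apply: (IH (fun=> 0) 0) => j; rewrite normr0.
Qed.

Lemma unif_smooth_der i a : unif_smooth a -> unif_smooth (sf_der i a).
Proof. by move=> ua k; exact: (ua k.+1).2. Qed.
End UniformlyBounded.

(** * Geometry of the metric on M x (0, T] *)

Section Geometry.
Variables (J : Type) (R : realType) (m : nat) (D : boxdom R m).
Local Notation fam := (smooth_family J D).
Variables (Gr : J -> 'rV[R]_m -> 'M[R]_m) (G H : 'I_m -> 'I_m -> fam).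
Hypothesis GE : forall j z a b, bdom D z -> Gr j z a b = G a b j z.
Hypothesis HE : forall j z a b, bdom D z -> invmx (Gr j z) a b = H a b j z.

Local Notation half := (sf_cst D (fun _ : J => 2^-1)).
Local Notation C := (chr (@sf_der J R m D) half G H).

Lemma pderiv_fam i (f : 'rV[R]_m -> R) (a : fam) j z :
  bdom D z -> (forall y, bdom D y -> f y = a j y) ->
  pderiv D i f z = sf_der i a j z.
Proof. by move=> Dz fa; exact: (sf_der_val i (g := fun=> f)). Qed.

Lemma christoffel_fam l i k j z : bdom D z ->
  christoffel D (Gr j) l i k z = C l i k j z.
Proof.
move=> Dz; rewrite /chr sf_mulE // sf_cstE // sf_sumE //.
congr (_ * _); apply: eq_bigr => p _.
rewrite sf_mulE // sf_addE // sf_addE // sf_oppE // HE //.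
by congr (_ * (_ + _ - _)); apply: pderiv_fam => // y Dy; exact: GE.
Qed.

Lemma riemann_fam i k l p j z : bdom D z ->
  riemann D (Gr j) i k l p z = curv (@sf_der J R m D) C i k l p j z.
Proof.
move=> Dz; rewrite /curv sf_addE // sf_addE // sf_oppE // sf_sumE //.
congr (_ - _ + _).
- by apply: pderiv_fam => // y; exact: christoffel_fam.
- by apply: pderiv_fam => // y; exact: christoffel_fam.
- have mulE (x y : fam) : (x * y) j z = x j z * y j z by exact: sf_mulE.
  apply: eq_bigr => q _; rewrite sf_addE // sf_oppE //.
  by rewrite (mulE (C q k l)) (mulE (C q i l)) !christoffel_fam.
Qed.

Lemma ricci_fam k l j z : bdom D z ->
  ricci D (Gr j) z k l = ric (@sf_der J R m D) C k l j z.
Proof.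
move=> Dz; rewrite mxE /ric sf_sumE //.
by apply: eq_bigr => i _; exact: riemann_fam.
Qed.

Lemma covd_fam k (A : J -> ctensor R m k) (a : {ffun 'I_k -> 'I_m} -> fam) j z I :
  bdom D z -> (forall j y I, bdom D y -> A j y I = a I j y) ->
  covd D (Gr j) (A j) z I
  = (sf_der (I ord0) (a [ffun s => I (lift ord0 s)])
     - \sum_(s < k) \sum_(l < m) C l (I ord0) (I (lift ord0 s))
         * a [ffun r => if r == s then l else I (lift ord0 r)]) j z.
Proof.
move=> Dz Aa; rewrite /covd sf_addE // sf_oppE // sf_sumE //.
congr (_ - _); first by apply: pderiv_fam => // y; exact: Aa.
apply: eq_bigr => s _; rewrite sf_sumE //; apply: eq_bigr => l _.
rewrite sf_mulE // christoffel_fam // ffunE Aa //; congr (_ * a _ j z).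
by apply/ffunP => r; rewrite !ffunE.
Qed.

Lemma covd_iter_unif (A : J -> ctensor R m 2) (u : fam)
    (e : {ffun 'I_2 -> 'I_m} -> fam) k :
  (forall i, sf_der i u = 0) ->
  (forall l i p, unif_smooth (C l i p)) ->
  (forall I, unif_smooth (e I)) ->
  (forall j z I, bdom D z -> A j z I = (u * e I) j z) ->
  exists f : {ffun 'I_(k + 2) -> 'I_m} -> fam, (forall I, unif_smooth (f I)) /\
    forall j z I, bdom D z ->
      covd_iter D (Gr j) (A j) k z I = (u * f I) j z.
Proof.
move=> du uC ue Ae; elim: k => [|k [f [uf fE]]]; first by exists e.
exists (fun I => sf_der (I ord0) (f [ffun s => I (lift ord0 s)])
     - \sum_(s < k + 2) \sum_(l < m) C l (I ord0) (I (lift ord0 s))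
         * f [ffun r => if r == s then l else I (lift ord0 r)]).
split=> [I|j z I Dz].
  have uS (I' : finType) (F : I' -> fam) :
      (forall i, unif_smooth (F i)) -> unif_smooth (\sum_i F i).
    move=> uF q; elim/big_rec: _ => [|i x _ ux].
      by apply: (@unif_smooth_cst J R m D (fun=> 0) 0) => j; rewrite normr0.
    by apply: unif_CkD => //; exact: uF.
  move=> q; apply: unif_CkD; first exact: unif_smooth_der.
  apply: unif_CkN; move: q; apply: (uS) => s; apply: (uS) => l q.
  by apply: unif_CkM; [exact: uC | exact: uf].
apply: etrans (covd_fam (A := fun j => covd_iter D (Gr j) (A j) k)
  (a := fun I => u * f I) j I Dz fE) _.
congr (sf_val _ j z).
rewrite (derM (sf_derP J D _)) du mul0r add0r mulrBr mulr_sumr; congr (_ - _).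
apply: eq_bigr => s _; rewrite mulr_sumr; apply: eq_bigr => l _.
by rewrite mulrCA.
Qed.
End Geometry.

(** * Coordinates on M x (0, T] *)

Lemma compact_image_within (T S : topologicalType) (f : T -> S) (K : set T) :
  compact K -> (forall x, K x -> {for x, continuous f}) -> compact (f @` K).
Proof.
move=> cK cf; apply: continuous_compact => //.
apply/subspace_continuousP => x Kx; apply: cvg_trans (cf x Kx).
exact/cvg_app/cvg_within.
Qed.

Section Charts.
Variables (R : realType) (n : nat) (U : set 'rV[R]_n) (T : R).
Hypothesis oU : open U.

Lemma txpointK (z : 'rV[R]_n.+1) : txpoint (tcoord z) (xcoord z) = z.
Proof.
apply/rowP => i; rewrite mxE.
by case: (unliftP ord0 i) => [j|] ->; rewrite ?mxE.
Qed.

Lemma tcoord_txpoint (t : R) (x : 'rV[R]_n) : tcoord (txpoint t x) = t.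
Proof. by rewrite /tcoord mxE unlift_none. Qed.

Lemma xcoord_txpoint (t : R) (x : 'rV[R]_n) : xcoord (txpoint t x) = x.
Proof. by apply/rowP => i; rewrite !mxE liftK. Qed.

Definition tx_set (I : set R) : set 'rV[R]_n.+1 :=
  [set z | U (xcoord z) /\ I (tcoord z)].

(** A spatial step leaves t fixed, so the admissible steps and the quotients coincide, whatever the
    time set [I]. It carries the geometry of each g(t) into the product. *)
Lemma pderiv_slice (I : set R) (f : R -> 'rV[R]_n -> R) i z :
  tx_set I z ->
  pderiv U i (f (tcoord z)) (xcoord z)
  = pderiv (tx_set I) (lift ord0 i) (fun w => f (tcoord w) (xcoord w)) z.
Proof.
move=> [Uz Iz]; rewrite /pderiv /diffquot; congr (lim _).
have xE (h : R) : xcoord (z + h *: delta_mx 0 (lift ord0 i))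
    = xcoord z + h *: delta_mx 0 i.
  by apply/rowP => j; rewrite !mxE eqxx /= (inj_eq lift_inj).
have tE (h : R) : tcoord (z + h *: delta_mx 0 (lift ord0 i)) = tcoord z.
  by rewrite /tcoord !mxE eqxx /= mulr0 addr0.
have -> : [set h : R | tx_set I (z + h *: delta_mx 0 (lift ord0 i))]
   = [set h | U (xcoord z + h *: delta_mx 0 i)].
  by rewrite predeqE => h; rewrite /tx_set /= xE tE; split=> [[]|].
by under [in RHS]eq_fun do rewrite xE tE.
Qed.

(** Steps back in time shorter than t keep it positive, and no step forward beyond T is demanded. *)
Lemma check_lower_box : lower_box (tx_set [set t | 0 < t <= T]).
Proof.
move=> z [Uz /andP[t0 tT]].
have /rv_nbhsP[e e0 eU] : nbhs (xcoord z) U by exact: open_nbhs_nbhs.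
exists (Num.min e (tcoord z)); first by rewrite lt_min e0.
move=> y yz; split.
  apply: eU => i; rewrite !mxE; have /andP[y1 y2] := yz (lift ord0 i).
  have em : Num.min e (tcoord z) <= e by rewrite ge_min lexx.
  by rewrite ger0_norm; lra.
have /andP[y1 y2] := yz ord0; rewrite /= -!/(tcoord _) in y1 y2 *.
have tm : Num.min e (tcoord z) <= tcoord z by rewrite ge_min lexx orbT.
by apply/andP; split; lra.
Qed.

(** Brings the smoothness of g and the flow equation, given on the closed time interval, to t > 0.
    The radius t excludes the slice t = 0. *)
Lemma check_near_flow z : tx_set [set t | 0 < t <= T] z ->
  tx_set [set t | 0 <= t <= T] z /\
  \forall y \near z, tx_set [set t | 0 < t <= T] y
    <-> tx_set [set t | 0 <= t <= T] y.
Proof.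
move=> [Uz /= /andP[t0 tT]]; split; first by split=> //=; rewrite ltW.
apply/rv_nbhsP; exists (tcoord z) => // y /(_ ord0).
rewrite -!/(tcoord _) ltr_norml => /andP[y1 y2].
have y0 : 0 < tcoord y by lra.
by split=> -[Uy /= /andP[_ yT]]; split=> //=; rewrite yT ?y0 ?ltW.
Qed.
End Charts.

Lemma posdef_unitmx (R : realType) (m : nat) (A : 'M[R]_m) :
  posdef A -> A \in unitmx.
Proof.
move=> [_ pA]; rewrite unitmxE unitfE; apply/negP => /eqP/eqP/det0P[v v0 vA].
by have := pA v v0; rewrite vA mul0mx mxE ltxx.
Qed.

Lemma posdef_diag_gt0 (R : realType) (m : nat) (A : 'M[R]_m) i :
  posdef A -> 0 < A i i.
Proof.
move=> [_ pA]; have := pA (delta_mx 0 i); rewrite -rowE mxE.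
have -> : (delta_mx 0 i : 'rV[R]_m) != 0.
  by apply/eqP => /rowP/(_ i)/eqP; rewrite !mxE !eqxx oner_eq0.
move=> /(_ isT); rewrite (bigD1 i) //= !mxE !eqxx mulr1 big1 ?addr0 //.
by move=> j ji; rewrite !mxE (negPf ji) andbF mulr0.
Qed.

(** * The metric over one chart as a matrix of families in N *)

Section CheckMetric.
Variables (R : realType) (n : nat) (M : manifold R n) (T : R).
Variables (g : metric_family M T) (c : atlas M).
Hypothesis hflow : ricci_flow g.

Local Notation U := (cimg (chart_at c)).
Let oU : open U := @cimg_open _ _ _ (chart_at c).
Let D : boxdom R n.+1 := BoxDom (@check_lower_box R n U T oU).

(** [J] labels values of N for which the tensor is positive definite over the chart. Injectivity of
    [Nof] ensures that finitely many values of N are finitely many indices, as [loc_bounded_w]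
    requires. *)
Variables (J : Type) (Nof : J -> nat).
Hypothesis Nof_gt0 : forall j, (0 < Nof j)%N.
Hypothesis Nof_inj : injective Nof.
Hypothesis check_pos : forall j z, bdom D z -> posdef (check_metric g (Nof j) c z).

Local Notation fam := (smooth_family J D).
Local Notation dD := (@sf_der J R n.+1 D).
Local Notation d := (fun i : 'I_n => dD (lift ord0 i)).
Local Notation half := (sf_cst D (fun _ : J => 2^-1)).

Let raw_g a b (z : 'rV[R]_n.+1) := g c (tcoord z) (xcoord z) a b.

Let Dflow z (Dz : bdom D z) := @check_near_flow R n U T z Dz.

Let smooth_g a b : smooth_on D (raw_g a b).
Proof.
move=> k; apply: Ck_restrict (mcomp_smooth g c a b k) => z; exact: Dflow.
Qed.

Let g_posdef z : bdom D z -> posdef (g c (tcoord z) (xcoord z)).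
Proof. by move=> /Dflow[[Uz tz] _]; exact: mcomp_posdef. Qed.

Let smooth_ginv a b :
  smooth_on D (fun z => invmx (g c (tcoord z) (xcoord z)) a b).
Proof.
apply: (smooth_invmx (bdomP D)) => [z Dz|i j]; last exact: smooth_g.
exact/posdef_unitmx/g_posdef.
Qed.

Let t_neq0 z : bdom D z -> tcoord z != 0.
Proof. by move=> [_ /= /andP[t0 _]]; rewrite gt_eqF. Qed.

Let G a b : fam := sf_mk (fun _ => smooth_g a b).
Let H a b : fam := sf_mk (fun _ => smooth_ginv a b).
Let t : fam := sf_mk (fun _ => smooth_coord (bdomP D) ord0).
Let s : fam :=
  sf_mk (fun _ => smooth_inv (bdomP D) t_neq0 (smooth_coord (bdomP D) ord0)).
Let N : fam := sf_cst D (fun j => (Nof j)%:R).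
Let u : fam := sf_cst D (fun j => (Nof j)%:R^-1).

Let GE a b j z : bdom D z -> G a b j z = g c (tcoord z) (xcoord z) a b.
Proof. exact: sf_mkE. Qed.
Let HE a b j z : bdom D z -> H a b j z = invmx (g c (tcoord z) (xcoord z)) a b.
Proof. exact: sf_mkE. Qed.
Let tE j z : bdom D z -> t j z = tcoord z. Proof. exact: sf_mkE. Qed.
Let sE j z : bdom D z -> s j z = (tcoord z)^-1. Proof. exact: sf_mkE. Qed.

Let half2 : half + half = 1.
Proof.
apply: sf_eq => j z Dz; rewrite sf_addE // sf_cstE // sf_1E //.
by rewrite [RHS]splitr mul1r.
Qed.

Let ts : t * s = 1.
Proof.
apply: sf_eq => j z Dz; rewrite sf_mulE // tE // sE // sf_1E //.
by rewrite mulfV // t_neq0.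
Qed.

Let N_neq0 j : (Nof j)%:R != 0 :> R.
Proof. by rewrite pnatr_eq0 -lt0n. Qed.

Let Nu : N * u = 1.
Proof.
by apply: sf_eq => j z Dz; rewrite sf_mulE // !sf_cstE // mulfV.
Qed.

Let Dt i : dD i t = (i == ord0)%:R.
Proof.
apply: sf_eq => j z Dz; rewrite sf_natE //.
rewrite -(pderiv_fam _ (f := fun y : 'rV[R]_n.+1 => y 0 ord0)) //; last first.
  by move=> y Dy; rewrite tE.
by apply: (pderiv_unique (bdomP D)) => //; exact: diffquot_coord.
Qed.

Let Gsym a b : G a b = G b a.
Proof.
apply: sf_eq => j z Dz; rewrite !GE //.
by have [gT _] := g_posdef Dz; rewrite -[in LHS]gT mxE.
Qed.

Let HG a b : \sum_p H a p * G p b = (a == b)%:R.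
Proof.
apply: sf_eq => j z Dz; rewrite sf_sumE // sf_natE //.
have /matrixP/(_ a b) := mulVmx (posdef_unitmx (g_posdef Dz)).
rewrite !mxE => <-; apply: eq_bigr => p _.
by rewrite sf_mulE // HE // GE.
Qed.

Local Notation C := (chr d half G H).

Let slice_fam i (f : R -> 'rV[R]_n -> R) (a : fam) j z :
  bdom D z -> (forall y, bdom D y -> f (tcoord y) (xcoord y) = a j y) ->
  pderiv U i (f (tcoord z)) (xcoord z) = dD (lift ord0 i) a j z.
Proof.
move=> Dz fa; apply: etrans (pderiv_slice (I := [set t | 0 < t <= T]) f i Dz) _.
exact: (pderiv_fam _ (D := D) (f := fun w => f (tcoord w) (xcoord w))).
Qed.

Let slice_christoffel l i k j z : bdom D z ->
  christoffel U (g c (tcoord z)) l i k (xcoord z) = C l i k j z.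
Proof.
move=> Dz; rewrite /chr sf_mulE // sf_cstE // sf_sumE //.
congr (_ * _); apply: eq_bigr => p _.
rewrite sf_mulE // sf_addE // sf_addE // sf_oppE // HE //.
congr (_ * (_ + _ - _)).
- apply: (slice_fam _ (f := fun t x => g c t x k p)) => // y Dy.
  by rewrite GE.
- apply: (slice_fam _ (f := fun t x => g c t x i p)) => // y Dy.
  by rewrite GE.
- apply: (slice_fam _ (f := fun t x => g c t x i k)) => // y Dy.
  by rewrite GE.
Qed.

Let slice_riemann i k l p j z : bdom D z ->
  riemann U (g c (tcoord z)) i k l p (xcoord z) = curv d C i k l p j z.
Proof.
move=> Dz; rewrite /curv sf_addE // sf_addE // sf_oppE // sf_sumE //.
congr (_ - _ + _).
- by apply: (slice_fam _ (f := fun t => christoffel U (g c t) p k l)) => // y Dy;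
    exact: slice_christoffel.
- by apply: (slice_fam _ (f := fun t => christoffel U (g c t) p i l)) => // y Dy;
    exact: slice_christoffel.
- have mulE (x y : fam) : (x * y) j z = x j z * y j z by exact: sf_mulE.
  apply: eq_bigr => q _; rewrite sf_addE // sf_oppE //.
  rewrite (mulE (C q k l)) (mulE (C q i l)).
  by rewrite !(slice_christoffel _ _ _ j Dz).
Qed.

Let slice_ricci k l j z : bdom D z ->
  ricci U (g c (tcoord z)) (xcoord z) k l = ric d C k l j z.
Proof.
move=> Dz; rewrite mxE /ric sf_sumE //.
by apply: eq_bigr => i _; exact: slice_riemann.
Qed.

Local Notation Rs := (scal d C H).

Let slice_scalar j z : bdom D z ->
  scalar_curvature U (g c (tcoord z)) (xcoord z) = Rs j z.
Proof.
move=> Dz; rewrite /scal sf_sumE //; apply: eq_bigr => i _.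
rewrite /ricci_endo sf_sumE //; apply: eq_bigr => p _.
by rewrite sf_mulE // HE // (slice_ricci _ _ j Dz).
Qed.

Let flow a b : dD ord0 (G a b) = - (ric d C a b + ric d C a b).
Proof.
apply: sf_eq => j z Dz; rewrite sf_oppE // sf_addE // -!slice_ricci //.
rewrite -(pderiv_fam _ (f := raw_g a b)) //; last by move=> y Dy; rewrite GE.
have [[Uz tz] nz] := Dflow Dz.
rewrite (eq_pderiv (D' := flow_dom T c) ord0 nz Dz (fun _ _ => erefl)).
have := hflow a b tz Uz; rewrite txpointK => e.
by apply: etrans e _; rewrite mulNr mulr2n mulrDl mul1r.
Qed.

Let q : fam := 1 + u * (t ^+ 2 * Rs *+ 2 + n%:R * t).

Let aE j z : bdom D z -> (t ^+ 2 * Rs *+ 2 + n%:R * t : fam) j z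
  = tcoord z ^+ 2 * Rs j z *+ 2 + n%:R * tcoord z.
Proof.
move=> Dz; have mulE (x y : fam) : (x * y) j z = x j z * y j z by exact: sf_mulE.
rewrite sf_addE // mulr2n sf_addE // -mulr2n (mulE (t ^+ 2) Rs) (mulE n%:R t).
by rewrite sf_expE // sf_natE // tE.
Qed.

Let qE j z : bdom D z -> q j z
  = 1 + (Nof j)%:R^-1 * (tcoord z ^+ 2 * Rs j z *+ 2 + n%:R * tcoord z).
Proof.
move=> Dz; rewrite -(aE j Dz) /q sf_addE // sf_1E //; congr (_ + _).
by rewrite sf_mulE // sf_cstE.
Qed.

Let lapseE j z : bdom D z -> check_metric g (Nof j) c z ord0 ord0
  = (Nof j)%:R / (2 * tcoord z ^+ 3) + Rs j z / tcoord z
    + n%:R / (2 * tcoord z ^+ 2).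
Proof. by move=> Dz; rewrite mxE unlift_none (slice_scalar j Dz). Qed.

(** Over the whole chart u a need not be small. But [q] is the lapse times 2t^3/N, and the lapse is
    a diagonal entry of a positive definite matrix. *)
Let q_neq0 j z : bdom D z -> q j z != 0.
Proof.
move=> Dz; have t0 := t_neq0 Dz.
have -> : q j z = check_metric g (Nof j) c z ord0 ord0
    * (2 * tcoord z ^+ 3 / (Nof j)%:R).
  by rewrite qE // lapseE //; field; rewrite N_neq0 t0.
rewrite mulf_neq0 //; first by rewrite gt_eqF //; exact/posdef_diag_gt0/check_pos.
by rewrite mulf_neq0 ?invr_eq0 ?N_neq0 // mulf_neq0 ?pnatr_eq0 ?expf_neq0.
Qed.

Let w : fam := sf_mk (fun j => smooth_inv (bdomP D) (@q_neq0 j) (sf_smooth q j)).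

Let wE : q * w = 1.
Proof.
apply: sf_eq => j z Dz; rewrite sf_mulE // [w j z]sf_mkE // sf_1E //.
by rewrite mulfV // q_neq0.
Qed.

Let Rs_indep j j' z : Rs j z = Rs j' z.
Proof.
have [Dz|Dz] := pselect (bdom D z); last by rewrite !sf_out.
by rewrite -!slice_scalar.
Qed.

Let ubR : unif_smooth Rs.
Proof. by apply: unif_smooth_indep => j j' z; exact: Rs_indep. Qed.

(* For N large, |u a| <= 1/2 on the compact set; the finitely many remaining N
   are treated one by one. *)
Let loc_bounded_w : loc_bounded w.
Proof.
move=> K cK KD; pose a : fam := t ^+ 2 * Rs *+ 2 + n%:R * t.
have la : loc_bounded a.
  apply: loc_bounded_indep => j j' z.
  have [Dz|Dz] := pselect (bdom D z); last by rewrite !sf_out.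
  by rewrite /a !aE // (Rs_indep j j').
have [A AP] := la K cK KD.
have [m Am] : exists m : nat, 2 * `|A| < m%:R.
  by exists (Num.bound (2 * `|A|)); rewrite archi_boundP // mulr_ge0.
have small k : exists B : R, forall j z,
    (Nof j < k)%N -> K z -> `|w j z| <= B.
  elim: k => [|k [B BP]]; first by exists 0.
  have [[j jk]|nj] := pselect (exists j, Nof j = k); last first.
    exists B => j z; rewrite ltnS leq_eqVlt => /orP[/eqP jk|]; last exact: BP.
    by case: nj; exists j.
  have [|B' B'P] := @compact_within_bounded R n.+1 K (w j) cK.
    by apply: continuous_subspaceW KD _; exact: Ck_continuous (sf_smooth w j 0).
  exists (Num.max B B') => j' z; rewrite ltnS leq_eqVlt le_max.
  move=> /orP[/eqP j'k|j'k] Kz; last by rewrite BP.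
  have -> : j' = j by apply: Nof_inj; rewrite j'k.
  by rewrite B'P // orbT.
have [B BP] := small m; exists (Num.max B 2) => j z Kz; rewrite le_max.
have [jm|mj] := ltnP (Nof j) m; first by rewrite BP.
apply/orP; right; have Dz := KD _ Kz; rewrite [w j z]sf_mkE // normfV.
have N0 : 0 < (Nof j)%:R :> R by rewrite ltr0n.
have ua : `|(Nof j)%:R^-1 * a j z| <= 2^-1.
  rewrite normrM normfV (gtr0_norm N0) mulrC ler_pdivrMr //.
  have mj' : m%:R <= (Nof j)%:R :> R by rewrite ler_nat.
  have := AP j z Kz; have := ler_norm A; lra.
have q2 : 2^-1 <= q j z.
  rewrite qE // -aE // -/a; move: ua; rewrite ler_norml => /andP[+ _].
  by lra.
rewrite -[leRHS]invrK lef_pV2 ?posrE ?invr_gt0 //.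
  by rewrite ger0_norm //; apply: le_trans q2; rewrite invr_ge0.
by rewrite normr_gt0 q_neq0.
Qed.
Let ub_indep (a : fam) : (forall j j' x, a j x = a j' x) -> unif_smooth a.
Proof. exact: unif_smooth_indep. Qed.
Let ub1 : unif_smooth (1 : fam). Proof. by apply: ub_indep => j j' x. Qed.
Let ubN (a : fam) : unif_smooth a -> unif_smooth (- a).
Proof. by move=> ua k; exact: unif_CkN. Qed.
Let ubD (a b : fam) : unif_smooth a -> unif_smooth b -> unif_smooth (a + b).
Proof. by move=> ua ub k; exact: unif_CkD. Qed.
Let ubM (a b : fam) : unif_smooth a -> unif_smooth b -> unif_smooth (a * b).
Proof. by move=> ua ub k; exact: unif_CkM. Qed.
Let ubG a b : unif_smooth (G a b). Proof. by apply: ub_indep => j j' x. Qed.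
Let ubH a b : unif_smooth (H a b). Proof. by apply: ub_indep => j j' x. Qed.
Let ubt : unif_smooth t. Proof. by apply: ub_indep => j j' x. Qed.
Let ubs : unif_smooth s. Proof. by apply: ub_indep => j j' x. Qed.
Let ubhalf : unif_smooth half. Proof. by apply: ub_indep => j j' x. Qed.
Let ubu : unif_smooth u.
Proof.
apply: (@unif_smooth_cst J R n.+1 D _ 1) => j.
rewrite normfV ger0_norm ?ler0n // invf_le1 ?ltr0n //.
by rewrite ler1n.
Qed.
Let ubw : unif_smooth w.
Proof.
apply: (unif_smooth_inv wE) => //; apply: ubD => //; apply: ubM => //.
apply: ubD; last by apply: ubM => //; exact: (ub_nat ub1 ubN ubD).
by rewrite mulr2n; apply: ubD; apply: ubM => //; apply: ubM.
Qed.

Local Notation Gc := (check_G half dD G H s N).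
Local Notation Hc := (check_H H t u w).

Let Gc_val j z a b : bdom D z ->
  check_metric g (Nof j) c z a b = Gc a b j z.
Proof.
move=> Dz; rewrite mxE /check_G.
case: (unlift ord0 a) => [a'|]; case: (unlift ord0 b) => [b'|];
  rewrite ?sf_0E //.
  by rewrite sf_mulE // GE // sE.
have t0 := t_neq0 Dz.
have mulE (x y : fam) : (x * y) j z = x j z * y j z by exact: sf_mulE.
have addE (x y : fam) : (x + y) j z = x j z + y j z by exact: sf_addE.
rewrite /check_lapse !addE (mulE half (N * _)) (mulE Rs s) (mulE half (n%:R * _)).
rewrite (mulE N) (mulE n%:R) !sf_expE // !sf_cstE // sf_natE // sE //.
by rewrite (slice_scalar j Dz); field.
Qed.

Let DN i : dD i N = 0. Proof. exact: sf_der_cst. Qed.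
Let Du i : dD i u = 0. Proof. exact: sf_der_cst. Qed.

Let Hc_val j z a b : bdom D z ->
  invmx (check_metric g (Nof j) c z) a b = Hc a b j z.
Proof.
move=> Dz; pose X : 'M[R]_n.+1 := \matrix_(a, b) Hc a b j z.
have XG : X *m check_metric g (Nof j) c z = 1%:M.
  apply/matrixP => i k; rewrite !mxE.
  have /(congr1 (fun y : fam => y j z)) := check_HG half2 HG ts Nu wE i k.
  rewrite sf_sumE // sf_natE // => <-; apply: eq_bigr => p _.
  by rewrite sf_mulE // mxE Gc_val.
suff -> : invmx (check_metric g (Nof j) c z) = X by rewrite mxE.
rewrite -[LHS]mul1mx -XG -mulmxA mulmxV ?mulmx1 //.
exact/posdef_unitmx/check_pos.
Qed.
Local Notation Cc := (chr dD half Gc Hc).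
Let f : fam := - (half * N * s).
Let err := alg_soliton_error half dD G H t s u N w.

Let fE j z : bdom D z -> - ((Nof j)%:R / (2 * tcoord z)) = f j z.
Proof.
move=> Dz; have t0 := t_neq0 Dz.
have mulE (x y : fam) : (x * y) j z = x j z * y j z by exact: sf_mulE.
rewrite /f sf_oppE // (mulE (half * N)) (mulE half) !sf_cstE // sE //.
by field.
Qed.

Let hessian_fam j z I : bdom D z ->
  hessian D (check_metric g (Nof j) c)
    (fun y => - ((Nof j)%:R / (2 * tcoord y))) z I
  = (dD (I ord0) (dD (I ord_max) f)
     - \sum_l Cc l (I ord0) (I ord_max) * dD l f) j z.
Proof.
move=> Dz; pose F j : ctensor R n.+1 0 :=
  ctensor_of_fun (fun y => - ((Nof j)%:R / (2 * tcoord y))).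
pose F1 j := covd D (check_metric g (Nof j) c) (F j).
have F1E j' y I' : bdom D y -> F1 j' y I' = dD (I' ord0) f j' y.
  move=> Dy.
  have := covd_fam Gc_val Hc_val (A := F) (a := fun=> f) j' I' Dy
    (fun j y _ => @fE j y).
  by rewrite big_ord0 subr0.
have := covd_fam Gc_val Hc_val (A := F1) (a := fun I => dD (I ord0) f)
  j I Dz F1E.
rewrite big_ord1 ffunE => e; apply: etrans e _.
have -> : lift ord0 (ord0 : 'I_1) = ord_max :> 'I_2 by exact: val_inj.
congr (sf_val (_ - _) j z); apply: eq_bigr => l _.
by rewrite ffunE eqxx.
Qed.

Let soliton_errorE j z I : bdom D z ->
  soliton_error g (Nof j) c z I = err (I ord0) (I ord_max) j z.
Proof.
move=> Dz; rewrite /err /alg_soliton_error sf_addE // sf_addE //.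
rewrite /soliton_error; congr (_ + _ + _).
- exact: (ricci_fam Gc_val Hc_val).
- exact: hessian_fam.
- by rewrite sf_mulE // sf_cstE // -Gc_val.
Qed.

Lemma check_covd_bounded k (K : set 'rV[R]_n.+1) :
  compact K -> K `<=` D ->
  exists B : R, forall j z, K z -> forall I,
    `|(Nof j)%:R * covd_iter (check_dom T c) (check_metric g (Nof j) c)
        (soliton_error g (Nof j) c) k z I| <= B.
Proof.
move=> cK KD.
have ubd i (a : fam) : unif_smooth a -> unif_smooth (dD i a).
  exact: unif_smooth_der.
have ubC l i p : unif_smooth (Cc l i p).
  exact: (ub_check_chr half2 (sf_derP J D) Gsym HG flow ts Nu Dt DN wE
    ub1 ubN ubD ubM ubd ubhalf ubG ubH ubt ubs ubu ubw).
have errE (I : {ffun 'I_2 -> 'I_n.+1}) :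
    exists e, unif_smooth e /\ err (I ord0) (I ord_max) = u * e.
  have [e ue ee] := modu_soliton_error half2 (sf_derP J D) (@sf_derC J R n.+1 D)
    Gsym HG flow ts Nu Dt DN wE ub1 ubN ubD ubM ubd ubhalf ubG ubH ubt ubs ubu
    ubw (I ord0) (I ord_max).
  by exists e; split=> //; rewrite -[RHS]add0r.
have [e eP] := choice errE.
have AE j z I : bdom D z -> soliton_error g (Nof j) c z I = (u * e I) j z.
  by move=> Dz; rewrite -(eP I).2; exact: soliton_errorE.
have [h [uh hE]] := covd_iter_unif Gc_val Hc_val
  (A := fun j => soliton_error g (Nof j) c) k Du ubC (fun I => (eP I).1) AE.
have hB I : exists B : R, forall j z, K z -> `|h I j z| <= B.
  exact: (uh I 0%N).1.
(* There are finitely many components, so the sum of the absolute values of their bounds serves for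
   all of them. *)
have [B BP] := choice hB; exists (\sum_I `|B I|) => j z Kz I.
have Dz := KD z Kz.
have -> : (Nof j)%:R * covd_iter (check_dom T c) (check_metric g (Nof j) c)
    (soliton_error g (Nof j) c) k z I = h I j z.
  have e1 := hE j z I Dz.
  apply: etrans (congr1 (fun y => (Nof j)%:R * y) e1) _.
  by rewrite sf_mulE // sf_cstE // mulrA mulfV ?mul1r.
apply: le_trans (BP I j z Kz) _; apply: le_trans (ler_norm _) _.
by rewrite (bigD1 I) //= lerDl; apply: sumr_ge0.
Qed.
End CheckMetric.

Theorem theorem2p1 (R : realType) (n : nat) (hn : (0 < n)%N)
    (M : manifold R n) (T : R) (hT : 0 < T) (g : metric_family M T)
    (hflow : ricci_flow g) (hcurv : bounded_curvature g) (k : nat) :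
  bounded_unif_loc T (fun N => (0 < N)%N /\ check_is_metric g N)
    (fun N c z I =>
       N%:R * covd_iter (check_dom T c) (check_metric g N c)
                (soliton_error g N c) k z I).
Proof.
move=> c K cK KD.
(* All admissible N together form the index type, so a single bound for the families is the bound
   independent of N. *)
pose J := {N : nat | (0 < N)%N /\ check_is_metric g N}.
have J_inj : injective (fun j : J => sval j).
  by move=> [N hN] [N' hN'] /= e; apply: eq_exist.
pose tx (q : M * R) := txpoint q.2 (cmap (chart_at c) q.1).
(* The chart map is continuous only within its domain. As the domain is open, this is continuity at
   each of its points. *)
have tx_cont q : K q -> {for q, continuous tx}.
  move=> /KD[cq _].
  have cmq : cmap (chart_at c) y @[y --> q.1] --> cmap (chart_at c) q.1.
    have /subspace_continuousP/(_ _ cq) cm := @cmap_cont _ _ _ (chart_at c).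
    move=> W /cm; rewrite /within /= => Wn.
    have dn : nbhs q.1 (cdom (chart_at c)).
      by apply: open_nbhs_nbhs; split=> //; exact: cdom_open.
    have Wn' : nbhs q.1 (fun y => cdom (chart_at c) y -> W (cmap (chart_at c) y)).
      exact: Wn.
    suff : nbhs q.1 (fun y => W (cmap (chart_at c) y)) by [].
    by apply: filterS (filterI Wn' dn) => y [Wy cy]; exact: Wy.
  move=> W /rv_nbhsP[e e0 eW].
  have n2 : \forall q' \near q, `|q.2 - q'.2| < e.
    have : q'.2 @[q' --> q] --> q.2 by exact: cvg_snd.
    by move=> /cvgrPdist_lt/(_ e e0).
  have n1 : \forall q' \near q, forall i,
      `|cmap (chart_at c) q.1 0 i - cmap (chart_at c) q'.1 0 i| < e.
    have c1 : q'.1 @[q' --> q] --> q.1 by exact: cvg_fst.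
    have c3 := cvg_comp _ _ c1 cmq.
    have := c3 [set y | forall i, `|cmap (chart_at c) q.1 0 i - y 0 i| < e].
    by apply; apply/rv_nbhsP; exists e.
  suff : nbhs q (fun q' => W (tx q')) by [].
  apply: filterS (filterI n1 n2) => q' [q1 q2]; apply: eW => i.
  rewrite !mxE; case: (unlift ord0 i) => [i'|] //; exact: q1.
have KD' : tx @` K `<=` check_dom T c.
  move=> _ [q Kq <-]; have [cq tq] := KD q Kq.
  rewrite /check_dom /= xcoord_txpoint tcoord_txpoint; split=> //.
  by exists q.1.
have pos (j : J) z : check_dom T c z -> posdef (check_metric g (sval j) c z).
  exact: (svalP j).2.
have [B BP] := check_covd_bounded hflow (fun j : J => (svalP j).1) J_inj pos k
  (compact_image_within cK tx_cont) KD'.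
exists B => N PN q Kq I.
by apply: (BP (exist _ N PN)); exists q.
Qed.
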